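(* Let $A$ be an Artinian local ring, let $B$ be a finitely generated standard $\mathbb{N}^r$-graded $A$-algebra, and let $M$ be a finitely generated $\mathbb{Z}^r$-graded $B$-module with $\dim(M)=d$. Let $\mathbf n\in\mathbb{Z}^r$ be such that $\mathbf n\ge-\mathbf 1$ and $|\mathbf n+\mathbf 1|\ge d$. Then: (i) For any $\nu\in\mathbb{Z}^r$, $e_{\mathbf n}(M(-\nu))=e_{\mathbf n}(M)$. (ii) (additivity) If $0\to M'\to M\to M''\to0$ is a short exact sequence of finitely generated graded $B$-modules, then $$e_{\mathbf n}(M)=e_{\mathbf n}(M')+e_{\mathbf n}(M'').$$ (iii) (associativity formula) $$e_{\mathbf n}(M)=\sum_{\substack{\mathfrak p\in\mathrm{Supp}(M)\\\dim(B/\mathfrak p)=d}}\mathrm{length}_{B_{\mathfrak p}}(M_{\mathfrak p})\,e_{\mathbf n}(B/\mathfrak p).$$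
   Context: $\mathbb{N}=\{0,1,2,\ldots\}$, $r\ge1$. Standard means that $[B]_{\mathbf 0}=A$ and $B$ is generated over $A$ by finitely many elements of degrees $\mathbf e_1,\ldots,\mathbf e_r$ (standard basis vectors). $|\mathbf n|=n_1+\cdots+n_r$, $\mathbf 1=(1,\ldots,1)$; inequalities of vectors are componentwise. $\dim$ is Krull dimension, $\dim(0)=-\infty$. $M(\nu)$ is the shifted module with $[M(\nu)]_\mu=[M]_{\nu+\mu}$. Mixed multiplicities via Hilbert series: for a finitely generated graded $B$-module $M$ of dimension $d$, the series $\mathrm{Hilb}_M(\mathbf t)=\sum_{\nu\in\mathbb{Z}^r}\mathrm{length}_A([M]_\nu)t_1^{\nu_1}\cdots t_r^{\nu_r}$ can be written as $\sum_{\mathbf n\in\mathbb{N}^r,|\mathbf n|=d}Q_{\mathbf n}(\mathbf t)/((1-t_1)^{n_1}\cdots(1-t_r)^{n_r})$ with $Q_{\mathbf n}\in\mathbb{Z}[t_1^{\pm1},\ldots,t_r^{\pm1}]$, $Q_{\mathbf n}(\mathbf 1)\ge0$, and the values $Q_{\mathbf n}(\mathbf 1)$ do not depend on the decomposition. For $\mathbf n\in\mathbb{Z}^r$ with $\mathbf n\ge-\mathbf 1$ and $|\mathbf n+\mathbf 1|\ge d$, set $e_{\mathbf n}(M)=Q_{\mathbf n+\mathbf 1}(\mathbf 1)$ if $|\mathbf n+\mathbf 1|=d$ and $e_{\mathbf n}(M)=0$ if $|\mathbf n+\mathbf 1|>d$ (in particular $e_{\mathbf n}(0)=0$). *)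

(* Defs.v *)
From HB Require Import structures.
From mathcomp Require Import all_boot all_order all_algebra.
From mathcomp Require Import generic_quotient ring_quotient finmap.
From mathcomp Require Import boolp classical_sets functions cardinality fsbigop.
From mathcomp Require Import constructive_ereal.
From mathcomp Require Import ring.

Set Implicit Arguments.
Unset Strict Implicit.
Unset Printing Implicit Defensive.

Import Order.TTheory GRing.Theory Num.Theory.

Local Open Scope ring_scope.
Local Open Scope quotient_scope.
Local Open Scope classical_set_scope.

(* The prime ideals as a type small enough to be collected in a [set]; the
   universe of [prime_idealr B] is too large for that. *)
Record spectrum (B : comNzRingType) := Spectrum {
  spec_pred :> B -> bool;
  spec_idealr : idealr_closed spec_pred;
  spec_prime : prime_idealr_closed spec_pred }.

HB.instance Definition _ (B : comNzRingType) (p : spectrum B) :=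
  isIdealr.Build B (spec_pred p) (spec_idealr p).
HB.instance Definition _ (B : comNzRingType) (p : spectrum B) :=
  isPrimeIdealrClosed.Build B (spec_pred p) (@spec_prime B p).
Definition prime_of (B : comNzRingType) (p : spectrum B) :
  prime_idealr B := spec_pred p.

HB.instance Definition _ B := gen_eqMixin (spectrum B).
HB.instance Definition _ B := gen_choiceMixin (spectrum B).

Lemma spectrum_ext (B : comNzRingType) (p q : spectrum B) : p =1 q -> p = q.
Proof.
case: p q => [P Pi Pp] [Q Qi Qp] /= /funext PQ; subst Q.
by congr Spectrum; exact: Prop_irrelevance.
Qed.

(* The action is a parameter so that the same notion covers the ideals of a
   ring, the submodules of a module, and the [A]-submodules of a [B]-module
   when [B] is an [A]-algebra. *)
Definition is_submod (R : Type) (V : zmodType) (act : R -> V -> V)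
    (N : set V) : Prop :=
  [/\ N 0, forall x y, N x -> N y -> N (x - y) & forall a x, N x -> N (act a x)].

Definition is_ideal (R : comNzRingType) (I : set R) : Prop :=
  is_submod (fun a x : R => a * x) I.

(* Supremum, in the extended integers, of the lengths k of the chains
   F 0 < F 1 < ... < F k of members of C; it is -oo if C is empty. *)
Definition chain_sup (T : Type) (C : set (set T)) : \bar int :=
  supremum -oo%E [set (k%:Z)%:E%E | k in [set k : nat | exists F : nat -> set T,
    (forall i, (i <= k)%N -> C (F i)) /\
    (forall i, (i < k)%N -> F i `<` F i.+1)]].

(* Chains of primes containing the annihilator of M; -oo if M = 0. *)
Definition krull_dim (R : comNzRingType) (M : lmodType R) : \bar int :=
  chain_sup [set P | exists p : spectrum R,
    P = [set a | p a] /\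
    forall a : R, (forall x : M, a *: x = 0) -> p a].

Definition mod_length (R : Type) (V : zmodType) (act : R -> V -> V)
    (N : set V) : \bar int :=
  chain_sup [set K | is_submod act K /\ K `<=` N].

Definition artinian (R : comNzRingType) : Prop :=
  forall F : nat -> set R, (forall i, is_ideal (F i)) ->
    (forall i, F i.+1 `<=` F i) ->
  exists k, forall i, (k <= i)%N -> F i = F k.

Definition maximal_ideal (R : comNzRingType) (m : set R) : Prop :=
  [/\ is_ideal m, m <> setT &
      forall J, is_ideal J -> m `<=` J -> J = m \/ J = setT].

Definition local_ring (R : comNzRingType) : Prop :=
  exists! m : set R, maximal_ideal m.

Definition fin_gen (R : nzRingType) (M : lmodType R) : Prop :=
  exists (k : nat) (g : 'I_k -> M), forall x : M,
    exists c : 'I_k -> R, x = \sum_i c i *: g i.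

(* V is the internal direct sum of the subgroups G nu. *)
Definition is_grading (r : nat) (V : zmodType) (G : 'rV[int]_r -> set V) :
    Prop :=
  [/\ forall nu, G nu 0 /\ (forall x y, G nu x -> G nu y -> G nu (x - y)),
      forall x, exists (s : seq 'rV[int]_r) (f : 'rV[int]_r -> V),
        (forall nu, G nu (f nu)) /\ x = \sum_(nu <- s) f nu &
      forall (s : seq 'rV[int]_r) (f : 'rV[int]_r -> V), uniq s ->
        (forall nu, G nu (f nu)) -> \sum_(nu <- s) f nu = 0 ->
        forall nu, nu \in s -> f nu = 0].

Definition unit_vec (r : nat) (i : 'I_r) : 'rV[int]_r := delta_mx 0 i.

(* An N^r-grading is a Z^r-grading that vanishes outside N^r. *)
Definition standard_graded (r : nat) (A : comNzRingType) (B : comAlgType A)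
    (G : 'rV[int]_r -> set B) : Prop :=
  [/\ is_grading G /\
        (forall mu nu a b, G mu a -> G nu b -> G (mu + nu) (a * b)),
      forall nu : 'rV[int]_r, ~ (forall i, 0 <= nu 0 i) -> G nu = [set 0],
      injective (in_alg B) /\ G 0 = range (in_alg B) &
      exists s : seq B,
        (forall x, x \in s -> exists i, G (unit_vec i) x) /\
        (forall S : {pred B}, GRing.subalg_closed S ->
           {subset s <= S} -> forall x, x \in S)].

Definition graded_module (r : nat) (B : comNzRingType)
    (G : 'rV[int]_r -> set B) (M : lmodType B) (H : 'rV[int]_r -> set M) :
    Prop :=
  is_grading H /\
  (forall mu nu b x, G mu b -> H nu x -> H (mu + nu) (b *: x)).

Definition shift (r : nat) (V : Type) (nu : 'rV[int]_r)
    (H : 'rV[int]_r -> set V) : 'rV[int]_r -> set V :=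
  fun mu => H (nu + mu).

Definition vsum (r : nat) (n : 'rV[int]_r) : int := \sum_i n 0 i.

Section MixedMultiplicity.
Variables (r : nat) (A : comNzRingType) (B : comAlgType A).

(* length_A of the graded pieces; they have finite length in the situation
   considered, so that [fine] loses nothing. *)
Definition hilb (M : lmodType B) (H : 'rV[int]_r -> set M)
    (nu : 'rV[int]_r) : int :=
  fine (mod_length (fun (a : A) (x : M) => in_alg B a *: x) (H nu)).

Definition laurent := {fsfun 'rV[int]_r -> int with 0}.

Definition eval1 (Q : laurent) : int := \sum_(mu <- finsupp Q) Q mu.

(* The coefficient of t^k in the expansion of 1/(1-t)^n as a power series,
   for n >= 0: 'C(n + k - 1, k) if k >= 0, and 0 if k < 0. The truncation of
   the predecessor gives the expected series 1 when n = 0. *)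
Definition inv_coef (n k : int) : int :=
  if 0 <= k then 'C((`|n| + `|k|).-1, `|k|)%N%:Z else 0.

Definition degs (d : \bar int) : set 'rV[int]_r :=
  [set n : 'rV[int]_r | (forall i, 0 <= n 0 i) /\ (vsum n)%:E%E = d].

(* The identity Hilb_M(t) = \sum_(|n| = d) Q_n(t) / \prod_i (1 - t_i)^(n_i)
   read coefficient by coefficient, with Q_n(1) >= 0, d = dim M. *)
Definition hilb_decomp (M : lmodType B) (H : 'rV[int]_r -> set M)
    (Q : 'rV[int]_r -> laurent) : Prop :=
  (forall n, degs (krull_dim M) n -> 0 <= eval1 (Q n)) /\
  (forall nu, hilb H nu =
     \sum_(n \in degs (krull_dim M)) \sum_(mu <- finsupp (Q n))
        Q n mu * \prod_i inv_coef (n 0 i) (nu 0 i - mu 0 i)).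

(* Meaningful for n >= -1 and |n + 1| >= dim M. *)
Definition mixed_mult (M : lmodType B) (H : 'rV[int]_r -> set M)
    (n : 'rV[int]_r) : int :=
  if `[< (vsum (n + const_mx 1))%:E%E = krull_dim M >] then
    xget 0 [set v | exists Q, hilb_decomp H Q /\ v = eval1 (Q (n + const_mx 1))]
  else 0.

End MixedMultiplicity.

(* 1/(1-t)^0 = 1, and 1/(1-t)^n.+1 is obtained from 1/(1-t)^n by partial sums *)
Lemma inv_coef0 (k : nat) : inv_coef 0 k = (k == 0)%:Z.
Proof. by case: k => [|k] //; rewrite /inv_coef /= bin_small. Qed.

Lemma inv_coefS (n k : nat) :
  inv_coef n.+1 k = \sum_(j < k.+1) inv_coef n j.
Proof.
elim: k => [|k IHk]; first by rewrite big_ord1 /inv_coef /= !bin0.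
rewrite big_ord_recr /= -IHk /inv_coef /= -PoszD; congr Posz.
by rewrite !addnS binS addnC.
Qed.

Section QuotientModule.
Variables (B : comNzRingType) (p : spectrum B).

Definition quot_mod := {ideal_quot (prime_of p)}.

HB.instance Definition _ := GRing.ComNzRing.on quot_mod.

Definition quot_scale (b : B) (x : quot_mod) : quot_mod :=
  (\pi_{ideal_quot (prime_of p)} b : quot_mod) * x.

Fact quot_scaleA a b x : quot_scale a (quot_scale b x) = quot_scale (a * b) x.
Proof. by rewrite /quot_scale rmorphM mulrA. Qed.

Fact quot_scale1 : left_id 1 quot_scale.
Proof. by move=> x; rewrite /quot_scale rmorph1 mul1r. Qed.

Fact quot_scaleDr : right_distributive quot_scale +%R.
Proof. by move=> a x y; rewrite /quot_scale mulrDr. Qed.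

Fact quot_scaleDl x : {morph quot_scale^~ x : a b / a + b}.
Proof. by move=> a b; rewrite /quot_scale rmorphD mulrDl. Qed.

HB.instance Definition _ := GRing.Zmodule_isLmodule.Build B quot_mod
  quot_scaleA quot_scale1 quot_scaleDr quot_scaleDl.

(* This is a grading whenever p is a homogeneous ideal. *)
Definition quot_grading (r : nat) (G : 'rV[int]_r -> set B) :
    'rV[int]_r -> set quot_mod :=
  fun nu => [set (\pi_{ideal_quot (prime_of p)} b : quot_mod) | b in G nu].

End QuotientModule.

Arguments quot_grading {B} p {r} G nu _.

Section LocalizedModule.
Variables (B : comNzRingType) (p : spectrum B).

Definition denom := {s : B | ~~ p s}.

Fact denom1_subproof : ~~ p 1.
Proof. by case: (spec_idealr p). Qed.
Definition denom1 : denom := Sub 1 denom1_subproof.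

Fact denomM_subproof (s t : denom) : ~~ p (val s * val t).
Proof.
apply/negP => /(@spec_prime B p)/orP[]; apply/negP.
  exact: (valP s).
exact: (valP t).
Qed.
Definition denomM (s t : denom) : denom :=
  Sub (val s * val t) (denomM_subproof s t).

Definition dval (s : denom) : B := val s.

Lemma dval1 : dval denom1 = 1. Proof. by []. Qed.
Lemma dvalM s t : dval (denomM s t) = dval s * dval t. Proof. by []. Qed.
Arguments dval : simpl never.

Variable M : lmodType B.

Definition loc_eq (x y : M * denom) : bool :=
  `[< exists u : denom,
        dval u *: (dval y.2 *: x.1) = dval u *: (dval x.2 *: y.1) >].

Fact loc_eq_equiv : equiv_class_of loc_eq.
Proof.
split=> [x|x y|y x z].
- by apply/asboolP; exists denom1.
- by apply/asboolP/asboolP => -[u e]; exists u.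
- move=> /asboolP[u e] /asboolP[v f]; apply/asboolP.
  exists (denomM (denomM u v) y.2); rewrite !dvalM.
  have {}e := congr1 (GRing.scale (dval v * dval z.2)) e.
  have {}f := congr1 (GRing.scale (dval u * dval x.2)) f.
  rewrite !scalerA in e f *.
  transitivity ((dval u * dval x.2 * dval v * dval z.2) *: y.1).
    apply: etrans (etrans e _); congr (_ *: _); ring.
  apply: etrans (etrans f _); congr (_ *: _); ring.
Qed.

Canonical loc_eq_equivrel := EquivRelPack loc_eq_equiv.
Canonical loc_eq_encModRel := defaultEncModRel loc_eq.

(* M_p; its elements are the classes of the pairs (x, s),
   seen as fractions x / s. *)
Definition loc_mod := {eq_quot loc_eq}.

HB.instance Definition _ : EqQuotient _ loc_eq loc_mod := EqQuotient.on loc_mod.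
HB.instance Definition _ := Choice.on loc_mod.

Lemma loc_eqP (x y : M * denom) :
  reflect (exists u : denom,
             dval u *: (dval y.2 *: x.1) = dval u *: (dval x.2 *: y.1))
          (\pi_loc_mod x == \pi_loc_mod y).
Proof. by rewrite piE; exact: asboolP. Qed.

Lemma eq_loc (x y : M * denom) :
  dval y.2 *: x.1 = dval x.2 *: y.1 -> \pi_loc_mod x = \pi_loc_mod y.
Proof. by move=> e; apply/eqP/loc_eqP; exists denom1; rewrite e. Qed.

Lemma loc_repr (x : M * denom) : exists u : denom,
  dval u *: (dval x.2 *: (repr (\pi_loc_mod x)).1)
    = dval u *: (dval (repr (\pi_loc_mod x)).2 *: x.1).
Proof. by apply/loc_eqP; rewrite reprK. Qed.

Definition add_frac (x y : M * denom) : M * denom :=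
  (dval y.2 *: x.1 + dval x.2 *: y.1, denomM x.2 y.2).

Definition loc_zero : loc_mod := \pi_loc_mod (0, denom1).
Definition loc_add (x y : loc_mod) : loc_mod :=
  \pi_loc_mod (add_frac (repr x) (repr y)).
Definition loc_opp (x : loc_mod) : loc_mod :=
  \pi_loc_mod (- (repr x).1, (repr x).2).

Lemma loc_addE (x y : M * denom) :
  loc_add (\pi_loc_mod x) (\pi_loc_mod y) = \pi_loc_mod (add_frac x y).
Proof.
rewrite /loc_add; have [u e] := loc_repr x; have [v f] := loc_repr y.
move: (repr _) (repr _) e f => y' x' e f.
apply/eqP/loc_eqP; exists (denomM u v); rewrite /= !dvalM.
have {}e := congr1 (GRing.scale (dval v * dval y.2 * dval y'.2)) e.
have {}f := congr1 (GRing.scale (dval u * dval x.2 * dval x'.2)) f.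
rewrite !scalerDr !scalerA in e f *; congr (_ + _).
  apply: etrans (etrans e _); congr (_ *: _); ring.
apply: etrans (etrans f _); congr (_ *: _); ring.
Qed.

Lemma loc_oppE (x : M * denom) :
  loc_opp (\pi_loc_mod x) = \pi_loc_mod (- x.1, x.2).
Proof.
rewrite /loc_opp; have [u e] := loc_repr x.
by apply/eqP/loc_eqP; exists u; rewrite /= !scalerN e.
Qed.

Lemma locP (P : loc_mod -> Prop) :
  (forall x s, P (\pi_loc_mod (x, s))) -> forall x, P x.
Proof. by move=> h x; rewrite -[x]reprK; case: (repr x). Qed.

Fact loc_addA : associative loc_add.
Proof.
elim/locP=> x s; elim/locP=> y t; elim/locP=> z u; rewrite !loc_addE.
apply: eq_loc; rewrite /= !dvalM !scalerDr !scalerA !addrA.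
by congr (_ *: _ + _ *: _ + _ *: _); ring.
Qed.

Fact loc_addC : commutative loc_add.
Proof.
elim/locP=> x s; elim/locP=> y t; rewrite !loc_addE.
apply: eq_loc; rewrite /= !dvalM !scalerDr !scalerA addrC.
by congr (_ *: _ + _ *: _); ring.
Qed.

Fact loc_add0 : left_id loc_zero loc_add.
Proof.
elim/locP=> x s; rewrite loc_addE; apply: eq_loc.
by rewrite /= dvalM dval1 scaler0 add0r scale1r mul1r.
Qed.

Fact loc_addN : left_inverse loc_zero loc_opp loc_add.
Proof.
elim/locP=> x s; rewrite loc_oppE loc_addE; apply: eq_loc.
by rewrite /= scalerN addNr !scaler0.
Qed.

HB.instance Definition _ :=
  GRing.isZmodule.Build loc_mod loc_addA loc_addC loc_add0 loc_addN.

Lemma loc_addrE (x y : M * denom) :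
  \pi_loc_mod x + \pi_loc_mod y = \pi_loc_mod (add_frac x y).
Proof. exact: loc_addE. Qed.

End LocalizedModule.

Section LocalizedRing.
Variables (B : comNzRingType) (p : spectrum B).

(* B_p, the localization of B as a module over itself *)
Definition loc_ring := loc_mod p B^o.

HB.instance Definition _ := GRing.Zmodule.on loc_ring.

Section Scale.
Variable M : lmodType B.

(* (a / s) * (x / t) = (a x) / (s t) *)
Definition loc_scale (a : loc_ring) (x : loc_mod p M) : loc_mod p M :=
  \pi_(loc_mod p M) ((repr a).1 *: (repr x).1, denomM (repr a).2 (repr x).2).

Lemma loc_scaleE (a : B^o * denom p) (x : M * denom p) :
  loc_scale (\pi_(loc_mod p B^o) a) (\pi_(loc_mod p M) x)
    = \pi_(loc_mod p M) ((a.1 : B) *: x.1, denomM a.2 x.2).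
Proof.
rewrite /loc_scale; have [u e] := loc_repr a; have [v f] := loc_repr x.
move: (repr _) (repr _) e f => x' a' e f.
apply/eqP/loc_eqP; exists (denomM u v); rewrite /= !dvalM.
have {}e : dval u * (dval a.2 * a'.1) = dval u * (dval a'.2 * a.1) :> B := e.
have {}f := congr1 (GRing.scale (dval u * dval a.2 * a'.1)) f.
have {}e := congr1 (GRing.mul (dval v * dval x'.2)) e.
rewrite !scalerA in f *.
transitivity ((dval u * dval a.2 * (a'.1 : B) * (dval v * dval x'.2)) *: x.1).
  apply: etrans (etrans f _); congr (_ *: _); ring.
congr (_ *: _); apply: etrans (etrans e _); ring.
Qed.

Definition loc_one : loc_ring := \pi_loc_ring (1 : B, denom1 p).

Fact loc_scale1 : left_id loc_one loc_scale.
Proof.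
elim/locP=> x s; rewrite loc_scaleE; apply: eq_loc.
by rewrite /= dvalM dval1 scale1r mul1r.
Qed.

Fact loc_scaleDr : right_distributive loc_scale +%R.
Proof.
elim/locP=> a s; elim/locP=> x t; elim/locP=> y u.
rewrite loc_addrE !loc_scaleE loc_addrE; apply: eq_loc.
rewrite /= !dvalM !scalerDr !scalerA.
by congr (_ *: _ + _ *: _); ring.
Qed.

Fact loc_scaleDl (x : loc_mod p M) : {morph loc_scale^~ x : a b / a + b}.
Proof.
elim/locP: x => x u; elim/locP=> a s; elim/locP=> b t.
rewrite loc_addrE !loc_scaleE loc_addrE; apply: eq_loc.
rewrite /= !dvalM !scalerDr !scalerA -scalerDl; congr (_ *: _).
rewrite /GRing.scale /=; ring.
Qed.

End Scale.

Definition loc_mul : loc_ring -> loc_ring -> loc_ring := @loc_scale B^o.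

Lemma loc_scaleA_gen (M : lmodType B) a b (x : loc_mod p M) :
  loc_scale a (loc_scale b x) = loc_scale (loc_mul a b) x.
Proof.
elim/locP: a => a s; elim/locP: b => b t; elim/locP: x => x u.
rewrite /loc_mul !loc_scaleE; apply: eq_loc.
rewrite /= !dvalM !scalerA; congr (_ *: _); rewrite /GRing.scale /=; ring.
Qed.

Fact loc_mulA : associative loc_mul.
Proof. by move=> a b c; exact: loc_scaleA_gen. Qed.

Fact loc_mulC : commutative loc_mul.
Proof.
elim/locP=> a s; elim/locP=> b t; rewrite /loc_mul !loc_scaleE.
apply: eq_loc; rewrite /= !dvalM /GRing.scale /=; ring.
Qed.

Fact loc_mul1 : left_id loc_one loc_mul.
Proof. exact: loc_scale1. Qed.

Fact loc_mulDl : left_distributive loc_mul +%R.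
Proof. by move=> a b c; exact: loc_scaleDl. Qed.

Fact loc_one_neq0 : loc_one != 0 :> loc_ring.
Proof.
apply/negP => /loc_eqP[u]; rewrite /GRing.scale /= dval1 !mulr0 !mulr1 => u0.
case: (spec_idealr p) => p0 _ _.
by have := valP u; rewrite -/(dval u) u0 => /negP; apply.
Qed.

HB.instance Definition _ := GRing.Zmodule_isComNzRing.Build loc_ring
  loc_mulA loc_mulC loc_mul1 loc_mulDl loc_one_neq0.

HB.instance Definition _ (M : lmodType B) :=
  GRing.Zmodule_isLmodule.Build loc_ring (loc_mod p M)
    (@loc_scaleA_gen M) (@loc_scale1 M) (@loc_scaleDr M) (@loc_scaleDl M).

(* Of finite length when p is minimal in the support of a finitely generated
   M over a Noetherian B. *)
Definition loc_length (M : lmodType B) : \bar int :=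
  mod_length (fun (a : loc_ring) (x : loc_mod p M) => a *: x) setT.

End LocalizedRing.

Definition supp (B : comNzRingType) (M : lmodType B) : set (spectrum B) :=
  [set p | exists x : loc_mod p M, x != 0].

(* Main.v *)
Require Import Defs.
From mathcomp Require Import all_boot all_order all_algebra.
From mathcomp Require Import generic_quotient ring_quotient finmap.
From mathcomp Require Import boolp classical_sets functions cardinality fsbigop.
From mathcomp Require Import constructive_ereal.
From mathcomp Require Import zify ring.

Set Implicit Arguments.
Unset Strict Implicit.
Unset Printing Implicit Defensive.

Import Order.TTheory GRing.Theory Num.Theory.

Local Open Scope ring_scope.
Local Open Scope quotient_scope.
Local Open Scope classical_set_scope.

(* Filter M by homogeneous submodules with successive quotients (B/q)(-delta),
   q a homogeneous prime containing Ann M.  The Hilbert function of M is then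
   the sum of the shifted Hilbert functions of the B/q, and for a prime p with
   dim B/p = dim M the length of M_p is the number of factors with q = p.  By
   Noetherian induction on q, the sequence
   0 -> (B/q)(-e_i) -> B/q -> B/(q + x) -> 0 with x of degree e_i outside q
   gives every B/q a decomposition of order dim B/q, hence of any larger order
   with all the Q_n(1) equal to 0.  Finally Q_n(1) is determined by the Hilbert
   function: for each m some finite combination of values of a function of nu
   kills the terms of order d with n <> m and is 1 on those with n = m.  Thus
   e_n is an additive, shift-invariant functional of the Hilbert function. *)

(** * Coefficients of rational functions with poles on t_i = 1 *)

(** [fine] sends an infinite length to 0, so a Hilbert function means something only once the
    lengths are known to be finite. Lengths are therefore handled as attained maxima of chains
    ([rel_length]), and finiteness is proved together with the rational form, by recursion along the
    degree e_i. Because the filtration of B/(q + x) is taken inside that induction, its statement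
    treats the lengths of the factors as a hypothesis. Noetherianity of [B] comes from that of the
    Artinian ring [A] and Hilbert's basis theorem. [mixed_mult] selects some decomposition of order
    exactly dim M with all Q_n(1) >= 0. Hence existence has to be shown with signs, while uniqueness
    is shown for arbitrary integer numerators. All modules in a statement are decomposed at the
    single order |n + 1|, even when their dimensions differ: an order above the dimension forces the
    values 0, which is what the definition prescribes there. The only dimension theory is that
    replacing a prime by a strictly larger one shortens the chains above it. *)

Lemma inv_coef_neg (n k : int) : k < 0 -> inv_coef n k = 0.
Proof. by move=> k0; rewrite /inv_coef leNgt k0. Qed.

Lemma inv_coefB (n k : int) : 0 <= n ->
  inv_coef (n + 1) k - inv_coef (n + 1) (k - 1) = inv_coef n k.
Proof.
case: n => // n _; case: (ltP k 0) => [k0|]; first by rewrite !inv_coef_neg //; lia.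
have -> : n%:Z + 1 = n.+1 by lia.
case: k => // -[|k] _.
  by rewrite (@inv_coef_neg _ (0 - 1)) // subr0 /inv_coef /= !bin0.
have -> : k.+1%:Z - 1 = k by lia.
by rewrite !inv_coefS big_ord_recr /= addrAC subrr add0r.
Qed.

(* For [m = 0] the functional sums the values over a window; for [m.+1] it is the
   functional for [m] applied to the first difference. *)
Lemma pole_functional (m K : nat) : exists s : seq (int * int),
  forall (n : nat) (mu : int), (n <= m)%N -> `|mu| <= K%:Z ->
    \sum_(t <- s) t.1 * inv_coef n (t.2 - mu) = (n == m)%:Z.
Proof.
elim: m K => [|m IHm] K.
  (* The window is [-K, K]: for order 0 the coefficient function is the indicator of [mu], hit
     exactly once, at j = mu + K. *)
  exists [seq (1, j%:Z - K%:Z) | j <- iota 0 (K + K).+1] => n mu.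
  rewrite leqn0 => /eqP-> muK; rewrite big_map.
  rewrite (bigD1_seq (absz (mu + K%:Z))) ?iota_uniq ?mem_iota; [|lia|by []].
  rewrite [fst _]/= [snd _]/=.
  have -> : (absz (mu + K%:Z))%:Z - K%:Z - mu = 0 by lia.
  rewrite /inv_coef /= big1 // => j jmu; rewrite mul1r.
  by case: ifP => // ge0; rewrite bin_small //; lia.
(* The bound grows by one because the difference also evaluates at [mu + 1]. *)
have [s Hs] := IHm K.+1.
exists (s ++ [seq (- t.1, t.2 - 1) | t <- s]) => n mu nm muK.
rewrite big_cat big_map /= -big_split /=.
under eq_bigr => t _ do rewrite mulNr -mulrBr addrAC.
case: n nm => [_|n nm]; last first.
  under eq_bigr => t _ do rewrite -addn1 PoszD inv_coefB //.
  by rewrite Hs //; lia.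
(* For n = 0 there is no pole to lower; the two halves are the functional at [mu] and at [mu + 1],
   with equal values that cancel. *)
under eq_bigr => t _ do rewrite mulrBr addrAC -[t.2 - 1 - _]addrA -opprD.
rewrite big_split /= sumrN.
rewrite Hs //; last by lia.
under eq_bigr => t _ do rewrite [1 + mu]addrC.
by rewrite Hs ?subrr //; lia.
Qed.

Section Combinatorics.
Variable r : nat.
Implicit Types (n mu nu : 'rV[int]_r) (h : 'rV[int]_r -> int).

(** The coefficient of t^nu in t^mu / (1 - t)^n. *)
Definition pole_term n mu nu : int := \prod_i inv_coef (n 0 i) (nu 0 i - mu 0 i).

(** An entry [(c, (n, mu))] stands for the summand c t^mu / (1 - t)^n; [pole_val] then computes
    Q_n(1). *)
Definition pole_sum (s : seq (int * ('rV[int]_r * 'rV[int]_r))) nu : int :=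
  \sum_(t <- s) t.1 * pole_term t.2.1 t.2.2 nu.

Definition pole_val (s : seq (int * ('rV[int]_r * 'rV[int]_r))) n : int :=
  \sum_(t <- s | t.2.1 == n) t.1.

Definition ndeg (d : nat) n := [forall i, 0 <= n 0 i] && (vsum n == d%:Z).

(* [h] is the coefficient function of [\sum_(|n| = d) Q_n / (1 - t)^n] with
   [Q_n(1) = e n]; the monomials of all the [Q_n] are put in one list. *)
Definition pole_dec (d : nat) h (e : 'rV[int]_r -> int) : Prop :=
  exists s : seq (int * ('rV[int]_r * 'rV[int]_r)),
  [/\ forall t, t \in s -> ndeg d t.2.1, h =1 pole_sum s &
    forall n, ndeg d n -> e n = pole_val s n].

Lemma ndegP d n : reflect ((forall i, 0 <= n 0 i) /\ vsum n = d%:Z) (ndeg d n).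
Proof.
apply: (iffP andP) => [[/forallP n0 /eqP nd]|[n0 nd]]; first by split.
by rewrite nd eqxx; split=> //; apply/forallP.
Qed.

Lemma vsumD n mu : vsum (n + mu) = vsum n + vsum mu.
Proof. by rewrite /vsum -big_split; apply: eq_bigr => i _; rewrite mxE. Qed.

Lemma vsum_unit (i : 'I_r) : vsum (unit_vec i) = 1.
Proof.
rewrite /vsum (bigD1 i) //= mxE !eqxx big1 ?addr0 // => j ji.
by rewrite mxE (negbTE ji) andbF.
Qed.

Lemma unit_vecE (i j : 'I_r) : unit_vec i 0 j = (j == i)%:Z.
Proof. by rewrite mxE eqxx /=; case: eqP. Qed.

(** Tensor product of the one-variable functionals of orders m_i. These control only exponents at
    most m_i, and this suffices: an [n] of the same total degree as [m] and different from it has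
    some n_i < m_i, and that factor of the product vanishes. *)
Lemma pole_functional_rV (d K : nat) m : ndeg d m ->
  exists L : seq (int * 'rV[int]_r), forall n mu, ndeg d n ->
    (forall i, `|mu 0 i| <= K%:Z) ->
    \sum_(t <- L) t.1 * pole_term n mu t.2 = (n == m)%:Z.
Proof.
move=> /ndegP[m0 md].
have /choice[S HS] : forall i : 'I_r, exists s : seq (int * int),
    forall (n : nat) (mu : int), (n <= absz (m 0%R i))%N -> `|mu| <= K%:Z ->
    \sum_(t <- s) t.1 * inv_coef n (t.2 - mu) = (n == absz (m 0%R i))%N%:Z.
  by move=> i; exact: pole_functional.
(* The lists are padded with the weight-zero entry [(0, 0)] to a common length, so that the product
   of sums expands over functions into ['I_N]. *)
pose N := \max_i size (S i).
pose w i (j : 'I_N) : int * int := nth (0, 0) (S i) j.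
have wS i F : F (0, 0) = 0 -> \sum_(t <- S i) F t = \sum_j F (w i j) :> int.
  move=> F0; rewrite (big_nth (0, 0)) big_mkord.
  have le : (size (S i) <= N)%N by apply: (leq_bigmax i).
  rewrite (big_ord_widen _ (fun j => F (nth (0, 0) (S i) j)) le) big_mkcond /=.
  by apply: eq_bigr => j _; case: ltnP => // sj; rewrite /w nth_default.
pose pt (f : {ffun 'I_r -> 'I_N}) : int * 'rV[int]_r :=
  (\prod_i (w i (f i)).1, \row_i (w i (f i)).2).
exists [seq pt f | f <- index_enum {ffun 'I_r -> 'I_N}].
move=> n mu /ndegP[n0 nd] muK; rewrite big_map.
transitivity (\prod_i \sum_(t <- S i) t.1 * inv_coef (n 0 i) (t.2 - mu 0 i)).
  under [RHS]eq_bigr => i _ do rewrite wS ?mul0r //.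
  rewrite (bigA_distr_bigA (fun i j => (w i j).1 *
    inv_coef (n 0 i) ((w i j).2 - mu 0 i))); apply: eq_bigr => f _.
  rewrite big_split /=; congr (_ * _); apply: eq_bigr => i _.
  by rewrite mxE.
have nE i : n 0 i = (absz (n 0 i)) by rewrite gez0_abs.
have [->|nm] := eqVneq n m.
  rewrite big1 // => i _; have -> : m 0 i = absz (m 0 i) by rewrite gez0_abs.
  by rewrite HS // eqxx.
have [i ni] : exists i, n 0 i < m 0 i.
  apply: contrapT => /forallNP le; case/eqP: nm.
  have {}le i : m 0 i <= n 0 i by rewrite leNgt; apply/negP; exact: le.
  apply/rowP => i; apply/eqP; rewrite -subr_eq0; apply/eqP.
  have : \sum_i (n 0 i - m 0 i) = 0.
    by rewrite sumrB -/(vsum n) -/(vsum m) nd md subrr.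
  move/eqP; rewrite psumr_eq0; last by move=> j _; rewrite subr_ge0.
  by move=> /allP/(_ i); rewrite mem_index_enum => /(_ isT)/= /eqP.
rewrite (bigD1 i) //= nE HS //; last by have := n0 i; lia.
by rewrite (_ : (_ == _)%N = false) ?mul0r //; have := n0 i; lia.
Qed.


(** The functional attached to [m], with [K] bounding the monomials of both lists, computes the
    value at [m] from [h] alone. *)
Lemma pole_dec_uniq d h e e' : pole_dec d h e -> pole_dec d h e' ->
  forall n, ndeg d n -> e n = e' n.
Proof.
move=> [s [sd hs es]] [s' [sd' hs' es']] m md; rewrite es // es' //.
have [K HK] : exists K : nat, forall t, t \in s ++ s' ->
    forall i, `|t.2.2 0 i| <= K%:Z.
  elim: (s ++ s') => [|t l [K HK]]; first by exists 0%N.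
  exists (K + \sum_i absz (t.2.2 0%R i))%N => u; rewrite inE => /orP[/eqP->|ul] i.
    rewrite (bigD1 i) //=; lia.
  by have := HK u ul i; lia.
have [L HL] := pole_functional_rV K md.
have val s0 : (forall t, t \in s0 -> ndeg d t.2.1) -> {subset s0 <= s ++ s'} ->
    pole_val s0 m = \sum_(u <- L) u.1 * pole_sum s0 u.2.
  move=> s0d sub; under eq_bigr => u _ do rewrite mulr_sumr.
  rewrite exchange_big /pole_val big_mkcond /= big_seq [RHS]big_seq.
  apply: eq_bigr => t ts0; under eq_bigr => u _ do rewrite mulrCA.
  rewrite -mulr_sumr HL ?s0d //; last by apply: HK; exact: sub.
  by case: eqP; rewrite ?mulr1 ?mulr0.
rewrite !val //; first by apply: eq_bigr => u _; rewrite -hs -hs'.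
  by move=> t ts; rewrite mem_cat ts orbT.
by move=> t ts; rewrite mem_cat ts.
Qed.

Lemma pole_dec0 d : pole_dec d (fun=> 0) (fun=> 0).
Proof.
by exists [::]; split=> [t||n _] //; [move=> nu|]; rewrite ?/pole_sum ?/pole_val big_nil.
Qed.

Lemma pole_decD d h h' e e' : pole_dec d h e -> pole_dec d h' e' ->
  pole_dec d (fun nu => h nu + h' nu) (fun n => e n + e' n).
Proof.
move=> [s [sd hs es]] [s' [sd' hs' es']]; exists (s ++ s'); split.
- by move=> t; rewrite mem_cat => /orP[/sd|/sd'].
- by move=> nu; rewrite hs hs' /pole_sum big_cat.
- by move=> n nd; rewrite es // es' // /pole_val big_cat.
Qed.

Lemma pole_dec_big (I : eqType) (l : seq I) d (h : I -> 'rV[int]_r -> int)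
    (e : I -> 'rV[int]_r -> int) : (forall i, i \in l -> pole_dec d (h i) (e i)) ->
  pole_dec d (fun nu => \sum_(i <- l) h i nu) (fun n => \sum_(i <- l) e i n).
Proof.
have sumE (f : I -> 'rV[int]_r -> int) : (fun x => \sum_(i <- [::]) f i x) = (fun=> 0) :> ('rV[int]_r -> int).
  by apply/funext => x; rewrite big_nil.
elim: l => [_|i l IHl he]; first by rewrite !sumE; exact: pole_dec0.
have sumE' (f : I -> 'rV[int]_r -> int) : (fun x => \sum_(j <- i :: l) f j x)
    = (fun x => f i x + \sum_(j <- l) f j x) :> ('rV[int]_r -> int).
  by apply/funext => x; rewrite big_cons.
rewrite !sumE'; apply: pole_decD; first by apply: he; rewrite mem_head.
by apply: IHl => j jl; apply: he; rewrite inE jl orbT.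
Qed.

Lemma pole_term_shift n mu nu del :
  pole_term n (mu + del) nu = pole_term n mu (nu - del).
Proof. by apply: eq_bigr => i _; rewrite !mxE opprD addrA addrAC. Qed.

Lemma pole_termB n mu nu i : 0 <= n 0 i ->
  pole_term (n + unit_vec i) mu nu - pole_term (n + unit_vec i) mu (nu - unit_vec i)
  = pole_term n mu nu.
Proof.
move=> n0.
have termE n' nu' : pole_term n' mu nu' = inv_coef (n' 0 i) (nu' 0 i - mu 0 i) *
    \prod_(j | j != i) inv_coef (n' 0 j) (nu' 0 j - mu 0 j).
  by rewrite /pole_term (bigD1 i).
rewrite !termE -(inv_coefB (nu 0 i - mu 0 i) n0) mulrBl.
rewrite !mxE !eqxx /= [nu 0 i - _ - _]addrAC.
by congr (_ * _ - _ * _); apply: eq_bigr => j ji;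
  rewrite !mxE (negbTE ji) andbF /= ?subr0 ?addr0.
Qed.

Lemma ndegD d n i : ndeg d n -> ndeg d.+1 (n + unit_vec i).
Proof.
move=> /ndegP[n0 nd]; apply/ndegP; split; last by rewrite vsumD vsum_unit nd; lia.
by move=> j; rewrite mxE unit_vecE; have := n0 j; case: eqP => _ /=; lia.
Qed.

Lemma pole_dec_shift d h e del : pole_dec d h e ->
  pole_dec d (fun nu => h (nu - del)) e.
Proof.
move=> [s [sd hs es]]; exists [seq (t.1, (t.2.1, t.2.2 + del)) | t <- s]; split.
- by move=> t /mapP[u us ->]; exact: (sd u us).
- move=> nu; rewrite hs /pole_sum big_map; apply: eq_bigr => t _ /=.
  by rewrite pole_term_shift.
- by move=> n nd; rewrite es // /pole_val big_map.
Qed.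

(** Numerator and denominator are multiplied by 1 - t_i; the new numerators vanish at 1. *)
Lemma pole_dec_raise (i : 'I_r) d h e : pole_dec d h e -> pole_dec d.+1 h (fun=> 0).
Proof.
move=> [s [sd hs es]].
exists ([seq (t.1, (t.2.1 + unit_vec i, t.2.2)) | t <- s] ++
        [seq (- t.1, (t.2.1 + unit_vec i, t.2.2 + unit_vec i)) | t <- s]); split.
- move=> t; rewrite mem_cat => /orP[] /mapP[u us ->]; exact: (ndegD i (sd u us)).
- move=> nu; rewrite hs /pole_sum big_cat !big_map /= -big_split big_seq [RHS]big_seq.
  apply: eq_bigr => t ts /=; rewrite pole_term_shift mulNr -mulrBr pole_termB //.
  by have /ndegP[] := sd t ts.
- by move=> n nd; rewrite /pole_val big_cat !big_map /= -big_split big1 // => t _; rewrite /= subrr.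
Qed.

Lemma pole_dec_lt (i : 'I_r) d d' h e : pole_dec d h e -> (d < d')%N ->
  pole_dec d' h (fun=> 0).
Proof.
move=> dec; elim: d' => // d' IHd'; rewrite ltnS leq_eqVlt => /orP[/eqP<-|/IHd'].
  exact: pole_dec_raise dec.
exact: pole_dec_raise.
Qed.

(** Differencing in direction i is injective on functions supported in a half-space, so an identity
    between such functions can be checked on differences. *)
Lemma bounded_below_eq0 (i : 'I_r) h (K : int) :
  (forall nu, h nu = h (nu - unit_vec i)) -> (forall nu, nu 0 i < K -> h nu = 0) ->
  forall nu, h nu = 0.
Proof.
move=> hi h0 nu.
have [k] := ubnP (absz (nu 0 i - K)%R); elim: k nu => // k IHk nu nuk.
case: (ltP (nu 0 i) K) => [/h0//|Knu]; rewrite hi.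
case: (ltP (nu 0 i - 1) K) => [lt|ge].
  by apply: h0; rewrite !mxE !eqxx /=; lia.
by apply: IHk; rewrite !mxE !eqxx /=; lia.
Qed.

(** Division of the series by 1 - t_i: numerators stay and each exponent gains e_i, so no term has
    n_i = 0. The vanishing of [h] for negative degrees excludes a shift-invariant summand. *)
Lemma pole_dec_sum (i : 'I_r) d h g e : pole_dec d g e ->
  (forall nu, h nu - h (nu - unit_vec i) = g nu) ->
  (forall nu, nu 0 i < 0 -> h nu = 0) ->
  pole_dec d.+1 h (fun n => if 0 < n 0 i then e (n - unit_vec i) else 0).
Proof.
move=> [s [sd hs es]] hg h0.
pose s' := [seq (t.1, (t.2.1 + unit_vec i, t.2.2)) | t <- s].
exists s'; split.
- by move=> t /mapP[u us ->]; exact: (ndegD i (sd u us)).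
(* -K bounds the degrees in t_i of all monomials from below, so [pole_sum s'] vanishes below it as
   well. *)
- have [K HK] : exists K : nat, forall t, t \in s -> - K%:Z <= t.2.2 0 i.
    elim: (s) => [|t l [K HK]]; first by exists 0%N.
    exists (K + absz (t.2.2 0%R i))%N => u; rewrite inE => /orP[/eqP->|ul].
      by move: (t.2.2 0 i) => x; lia.
    by have := HK u ul; move: (u.2.2 0 i) (t.2.2 0 i) => x y; lia.
  move=> nu; apply/eqP; rewrite -subr_eq0; apply/eqP.
  apply: (@bounded_below_eq0 i (fun nu => h nu - pole_sum s' nu) (- K%:Z)) => {}nu.
    have : pole_sum s' nu - pole_sum s' (nu - unit_vec i) = pole_sum s nu.
      rewrite /pole_sum !big_map -sumrB; apply: eq_big_seq => t ts /=.
      by rewrite -mulrBr pole_termB //; have /ndegP[] := sd t ts.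
    by have := hg nu; rewrite hs; lia.
  move=> nuK; rewrite h0; last by lia.
  rewrite /pole_sum big_map big_seq big1 ?subr0 // => t ts /=.
  rewrite /pole_term (bigD1 i) //= inv_coef_neg ?mul0r ?mulr0 //.
  by have := HK t ts; move: (t.2.2 0 i) => x; lia.
- move=> n nd; rewrite /pole_val big_map /=.
  case: ifPn => n0; last first.
    rewrite big_seq_cond big1 // => t /andP[ts /eqP tn]; case/negP: n0.
    rewrite -tn mxE unit_vecE eqxx.
    by have /ndegP[/(_ i)] := sd t ts; move: (t.2.1 0 i) => x; lia.
  rewrite es.
    by apply: eq_bigl => t; rewrite eq_sym subr_eq eq_sym.
  move/ndegP: nd => [ng nd]; apply/ndegP; split; last first.
    have := vsumD (n - unit_vec i) (unit_vec i).
    rewrite subrK vsum_unit nd; lia.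
  move=> j; rewrite mxE [X in _ + X]mxE unit_vecE; have := ng j.
  by case: eqP => [->|] /=; lia.
Qed.

End Combinatorics.

(** * Chains and lengths *)

Section Chains.
Variable T : Type.
Implicit Types (C : set (set T)) (X Y : set T).

(** Naming the top member lets a chain be extended upwards and gives the induction
    [chain_to_ind]. *)
Definition chain_to C (j : nat) X : Prop := exists F : nat -> set T,
  [/\ forall i, (i <= j)%N -> C (F i), forall i, (i < j)%N -> F i `<` F i.+1 & F j = X].

Definition max_chain C (k : nat) : Prop :=
  (exists X, chain_to C k X) /\ forall j X, chain_to C j X -> (j <= k)%N.

Lemma chain_to0 C X : C X -> chain_to C 0 X.
Proof. by move=> CX; exists (fun=> X); split. Qed.

Lemma chain_toS C j X Y : chain_to C j X -> C Y -> X `<` Y -> chain_to C j.+1 Y.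
Proof.
move=> [F [CF F_lt FX]] CY XY.
exists (fun i => if (i <= j)%N then F i else Y); split.
- by move=> i _; case: ifP => // /CF.
- move=> i; rewrite ltnS => ij; rewrite ij; case: ltnP => [|ji]; first exact: F_lt.
  by rewrite (_ : i = j) ?FX //; apply/eqP; rewrite eqn_leq ij.
- by rewrite ltnn.
Qed.

Lemma chain_to_ind C (P : nat -> set T -> Prop) :
  (forall X, C X -> P 0%N X) ->
  (forall j X Y, P j X -> C X -> C Y -> X `<` Y -> P j.+1 Y) ->
  forall j X, chain_to C j X -> P j X.
Proof.
move=> P0 PS j X [F [CF F_lt <-]] {X}.
elim: j CF F_lt => [|j IHj] CF F_lt; first exact/P0/CF.
apply: (PS j (F j)); [|exact: CF|exact: CF|exact: F_lt].
by apply: IHj => i ij; [apply: CF; exact: leqW|apply: F_lt; exact: leqW].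
Qed.

Lemma chain_to_mem C j X : chain_to C j X -> C X.
Proof. by move: j X; apply: chain_to_ind. Qed.

Lemma chain_to_sub C C' j X : C `<=` C' -> chain_to C j X -> chain_to C' j X.
Proof. by move=> sub [F [CF ? ?]]; exists F; split=> // i /CF /sub. Qed.

Lemma chain_supE C : chain_sup C =
  supremum -oo%E [set (k%:Z)%:E%E | k in [set k | exists X, chain_to C k X]].
Proof.
rewrite /chain_sup; congr (supremum _ [set _ | _ in _]).
apply/seteqP; split=> k /=; first by move=> [F [CF F_lt]]; exists (F k), F.
by move=> [X [F [CF F_lt _]]]; exists F.
Qed.

(** [supremum] picks a least upper bound only if there is one. Here a bounded set of lengths has a
    greatest element, and the only upper bound of an unbounded one is +oo. *)
Lemma chain_sup_supremum C : (exists k X, chain_to C k X) ->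
  supremums [set (k%:Z)%:E%E | k in [set k | exists X, chain_to C k X]] (chain_sup C).
Proof.
move=> [k0 ne0]; rewrite chain_supE /supremum; set A := [set _ | _ in _].
have Ak0 : A (k0%:Z)%:E by exists k0.
case: eqP => [A0|_]; first by have : A (k0%:Z)%:E by []; rewrite A0.
apply: xgetPex.
have [[N HN]|unb] := pselect (exists N : nat, forall k X, chain_to C k X -> (k <= N)%N).
  have exk : exists k, `[< exists X, chain_to C k X >] by exists k0; apply/asboolP.
  have bk k : `[< exists X, chain_to C k X >] -> (k <= N)%N.
    by move=> /asboolP[X /HN].
  case: (ex_maxnP exk bk) => m /asboolP Cm mmax; exists (m%:Z)%:E; split.
    move=> _ [k Ck <-]; rewrite lee_fin lez_nat; apply: mmax; exact/asboolP.
  by move=> y /(_ (m%:Z)%:E); apply; exists m.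
exists +oo%E; split=> [y _|]; first exact: leey.
move=> y yub; rewrite leye_eq; case: y yub => [y|//|] yub.
  exfalso; apply: unb; exists (absz y) => k X Ck.
  have := yub (k%:Z)%:E; rewrite lee_fin => /(_ (ex_intro2 _ _ k (ex_intro _ X Ck) erefl)).
  by lia.
by have := yub _ Ak0; rewrite leeNy_eq.
Qed.

Lemma chain_sup_ge C k X : chain_to C k X -> ((k%:Z)%:E <= chain_sup C)%E.
Proof.
move=> Ck; have [ub _] := @chain_sup_supremum C (ex_intro _ k (ex_intro _ X Ck)).
by apply: ub; exists k => //; exists X.
Qed.

Lemma chain_sup_le C (y : \bar int) :
  (forall k X, chain_to C k X -> ((k%:Z)%:E <= y)%E) -> (chain_sup C <= y)%E.
Proof.
move=> Cy; have [ne|none] := pselect (exists k X, chain_to C k X).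
  have [_ lb] := chain_sup_supremum ne.
  by apply: lb => _ [k [X Ck] <-]; exact: Cy Ck.
rewrite chain_supE.
have -> : [set (k%:Z)%:E%E | k in [set k | exists X, chain_to C k X]] = set0 :> set (\bar int).
  by rewrite -subset0 => x [k [X Ck] _]; apply: none; exists k, X.
by rewrite supremum0 leNye.
Qed.

Lemma max_chainE C k : max_chain C k -> chain_sup C = (k%:Z)%:E.
Proof.
move=> [[X Ck] kmax]; apply/eqP; rewrite eq_le (chain_sup_ge Ck) andbT.
by apply: chain_sup_le => j Y /kmax; rewrite lee_fin lez_nat.
Qed.

Lemma max_chain_uniq C k k' : max_chain C k -> max_chain C k' -> k = k'.
Proof. by move=> /max_chainE + /max_chainE => ->[]. Qed.

End Chains.

(** * Length of a subquotient and its additivity *)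

Section Length.
Variables (R : Type) (V : zmodType) (act : R -> V -> V).
Implicit Types (N L P K : set V).

(** The length of L/N, read from submodules between [N] and [L] so that no quotient module is
    formed; it holds of no [k] when the length is infinite. *)
Definition rel_length N L (k : nat) : Prop :=
  max_chain [set K | [/\ is_submod act K, N `<=` K & K `<=` L]] k.

Definition add_set N L : set V := [set x | exists y z, [/\ N y, L z & x = y + z]].

Hypothesis actD : forall a x y, act a (x + y) = act a x + act a y.

Lemma submodD N x y : is_submod act N -> N x -> N y -> N (x + y).
Proof.
move=> [N0 NB Na] Nx Ny; have := NB _ _ Nx (NB _ _ N0 Ny); by rewrite sub0r opprK.
Qed.

Lemma submod_sum N (I : eqType) (s : seq I) (F : I -> V) : is_submod act N ->
  (forall i, i \in s -> N (F i)) -> N (\sum_(i <- s) F i).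
Proof.
move=> Ns NF; rewrite big_seq; elim/big_ind: _ => //; first by case: Ns.
by move=> x y; exact: submodD.
Qed.

Lemma is_submodI N L : is_submod act N -> is_submod act L -> is_submod act (N `&` L).
Proof.
move=> [N0 NB Na] [L0 LB La]; split=> // [x y [? ?] [? ?]|a x [? ?]].
  by split; [exact: NB|exact: LB].
by split; [exact: Na|exact: La].
Qed.

Lemma is_submod_add N L : is_submod act N -> is_submod act L ->
  is_submod act (add_set N L).
Proof.
move=> [N0 NB Na] [L0 LB La]; split.
- by exists 0, 0; rewrite addr0.
- move=> _ _ [x [y [Nx Ly ->]]] [z [t [Nz Lt ->]]].
  by exists (x - z), (y - t); split; [exact: NB|exact: LB|rewrite opprD addrACA].
- move=> a _ [x [y [Nx Ly ->]]].
  by exists (act a x), (act a y); split; [exact: Na|exact: La|exact: actD].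
Qed.

Lemma modular_eq N L L' : is_submod act N -> is_submod act L -> is_submod act L' ->
  L `<=` L' -> L `&` N = L' `&` N -> add_set L N = add_set L' N -> L = L'.
Proof.
move=> Ns Ls L's LL' eI eA; apply/seteqP; split=> // x L'x.
have : add_set L' N x by exists x, 0; rewrite addr0; split=> //; case: Ns.
rewrite -eA => -[y [z [Ly Nz e]]]; rewrite e; apply: (submodD Ls) => //.
suff : (L `&` N) z by case.
rewrite eI; split=> //.
have -> : z = x - y by rewrite e addrC addKr.
by case: L's => _ L'B _; apply: L'B => //; exact: LL'.
Qed.

Lemma subset_neq_proper (X Y : set V) : X `<=` Y -> X <> Y -> X `<` Y.
Proof.
move=> XY ne; rewrite properEneq; split=> //; exact/eqP.
Qed.

(** Chains are concatenated for the lower bound. For the upper bound a chain is cut with [L] and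
    added to [L]; by modularity each strict step stays strict in at least one of the two resulting
    chains. *)
Lemma rel_lengthD N L P k m : is_submod act N -> is_submod act L -> is_submod act P ->
  N `<=` L -> L `<=` P ->
  rel_length N L k -> rel_length L P m -> rel_length N P (k + m)%N.
Proof.
move=> Ns Ls Ps NL LP [[X Xk] kmax] [[Y Ym] mmax]; split.
  exists Y; move: m Y Ym {mmax}; apply: chain_to_ind.
    move=> Y [Ys LY YP]; rewrite addn0.
    have Ck : chain_to [set K | [/\ is_submod act K, N `<=` K & K `<=` P]] k X.
      apply: chain_to_sub Xk => K [? ? KL]; split=> //; exact: subset_trans LP.
    have [Xs NX XL] := chain_to_mem Xk.
    (* The bottom [Y] of the upper chain may differ from the top [X] of the lower one; then [Y]
       takes the place of [X]. *)
    have [->|XY] := pselect (Y = X); first by [].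
    case: k Xk Ck kmax => [|k] Xk Ck kmax.
      by apply: chain_to0; split=> //; exact: subset_trans LY.
    have XY' : X `<` Y by apply: subset_neq_proper;
      [exact: subset_trans LY|move=> e; apply: XY].
    case: Ck => F [CF F_lt FX].
    exists (fun i => if (i <= k)%N then F i else Y); split.
    - move=> i ik; case: ifP => _; first exact: CF.
      by split=> //; exact: subset_trans LY.
    - move=> i; rewrite ltnS => ik; rewrite ik; case: ltnP => [lt|ki].
        by apply: F_lt; exact: leqW.
      have {ki ik}-> : i = k by apply/eqP; rewrite eqn_leq ik.
      have := F_lt k (ltnSn k); rewrite FX => lt1.
      case: lt1 XY' => [l1 n1] [l2 n2]; split; first exact: subset_trans l2.
      by move=> YF; apply: n1; exact: subset_trans YF.
    - by rewrite ltnn.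
  move=> j X' Y' IH [X's LX' X'P] [Y's LY' Y'P] XY'; rewrite addnS.
  by apply: chain_toS IH _ XY'; split=> //; exact: subset_trans LY'.
move=> j Z Zj.
suff [a [b [jab Ka Kb]]] : exists a b, [/\ (j <= a + b)%N,
    chain_to [set K | [/\ is_submod act K, N `<=` K & K `<=` L]] a (Z `&` L) &
    chain_to [set K | [/\ is_submod act K, L `<=` K & K `<=` P]] b (add_set Z L)].
  by have := kmax _ _ Ka; have := mmax _ _ Kb; lia.
have CI Z' : is_submod act Z' -> N `<=` Z' -> Z' `<=` P ->
    [/\ is_submod act (Z' `&` L), N `<=` Z' `&` L & Z' `&` L `<=` L].
  move=> Z's NZ' Z'P; split; [exact: is_submodI| |by move=> x []].
  by move=> x Nx; split; [exact: NZ'|exact: NL].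
have CA Z' : is_submod act Z' -> N `<=` Z' -> Z' `<=` P ->
    [/\ is_submod act (add_set Z' L), L `<=` add_set Z' L & add_set Z' L `<=` P].
  move=> Z's NZ' Z'P; split; first exact: is_submod_add.
    by move=> x Lx; exists 0, x; rewrite add0r; split=> //; case: Z's.
  by move=> _ [x [y [/Z'P Px /LP Py ->]]]; exact: submodD.
move: j Z Zj; apply: chain_to_ind => [Z [Zs NZ ZP]|j X' Y' [a [b [jab Ka Kb]]]].
  by exists 0%N, 0%N; split=> //; apply: chain_to0; [exact: CI|exact: CA].
move=> [X's NX' X'P] [Y's NY' Y'P] [X'Y' Y'X'].
have [eI|neI] := pselect (X' `&` L = Y' `&` L).
  have [eA|neA] := pselect (add_set X' L = add_set Y' L).
    by case: Y'X'; rewrite (modular_eq Ls X's Y's X'Y' eI eA).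
  exists a, b.+1; split; [by rewrite addnS|by rewrite -eI|].
  apply: chain_toS Kb (CA _ Y's NY' Y'P) _; apply: subset_neq_proper => //.
  by move=> _ [x [y [/X'Y' ? ? ->]]]; exists x, y.
have Ka' : chain_to [set K | [/\ is_submod act K, N `<=` K & K `<=` L]] a.+1 (Y' `&` L).
  apply: chain_toS Ka (CI _ Y's NY' Y'P) _; apply: subset_neq_proper => //.
  by move=> x [/X'Y' ? ?].
have [eA|neA] := pselect (add_set X' L = add_set Y' L).
  by exists a.+1, b; split; [rewrite addSn|by []|rewrite -eA].
exists a.+1, b.+1; split; [lia|by []|].
apply: chain_toS Kb (CA _ Y's NY' Y'P) _; apply: subset_neq_proper => //.
by move=> _ [x [y [/X'Y' ? ? ->]]]; exists x, y.
Qed.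

Lemma rel_length0 N : is_submod act N -> rel_length N N 0.
Proof.
move=> Ns; split; first by exists N; apply: chain_to0; split.
move=> j X [F [CF F_lt _]]; case: j CF F_lt => // j CF F_lt.
have [_ _ le1] := CF 1%N isT; have [_ ge0 _] := CF 0%N isT.
by case: (F_lt 0%N isT) => _; case; exact: subset_trans ge0.
Qed.

Lemma rel_length1 N L : is_submod act N -> is_submod act L -> N `<` L ->
  (forall K, is_submod act K -> N `<=` K -> K `<=` L -> K = N \/ K = L) ->
  rel_length N L 1.
Proof.
move=> Ns Ls NL NKL; have [sub nsub] := NL; split.
  by exists L; apply: chain_toS NL; [apply: chain_to0|]; split.
move=> j X [F [CF F_lt _]]; case: j CF F_lt => [|[|j]] // CF F_lt; exfalso.
have [s0 N0 L0] := CF 0%N isT; have [s1 N1 L1] := CF 1%N isT; have [s2 N2 L2] := CF 2%N isT.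
have [l01 n01] := F_lt 0%N isT; have [l12 n12] := F_lt 1%N isT.
by case: (NKL _ s1 N1 L1) => e1; [apply: n01; rewrite e1|apply: n12; rewrite e1].
Qed.

Lemma mod_lengthE N k : rel_length [set 0] N k -> mod_length act N = (k%:Z)%:E.
Proof.
move/max_chainE <-; rewrite /mod_length; congr chain_sup; apply/seteqP; split=> K.
  by move=> [Ks KN]; split=> // _ ->; case: Ks.
by move=> [].
Qed.

End Length.

Lemma max_chain_iso (T T' : Type) (C : set (set T)) (C' : set (set T'))
    (f : set T -> set T') (g : set T' -> set T) (k : nat) :
  (forall X, C X -> C' (f X)) -> (forall Y, C' Y -> C (g Y)) ->
  (forall X Y, X `<=` Y -> f X `<=` f Y) -> (forall X Y, X `<=` Y -> g X `<=` g Y) ->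
  (forall X, C X -> g (f X) = X) -> (forall Y, C' Y -> f (g Y) = Y) ->
  max_chain C k -> max_chain C' k.
Proof.
move=> Cf Cg fS gS fK gK [[X0 X0k] kmax]; split.
  exists (f X0); move: k X0 X0k {kmax}; apply: chain_to_ind.
    by move=> X CX; apply: chain_to0; exact: Cf.
  move=> j X Y IH CX CY [XY nYX]; apply: (chain_toS IH); first exact: Cf.
  split; first exact: fS.
  by move=> le; apply: nYX; rewrite -(fK X) // -(fK Y) //; exact: gS.
move=> j Y Yj; apply: (kmax j (g Y)); move: j Y Yj; apply: chain_to_ind.
  by move=> Y CY; apply: chain_to0; exact: Cg.
move=> j X Y IH CX CY [XY nYX]; apply: (chain_toS IH); first exact: Cg.
split; first exact: gS.
by move=> le; apply: nYX; rewrite -(gK X) // -(gK Y) //; exact: fS.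
Qed.

Section LengthIso.
Variables (R : Type) (V V' : zmodType) (act : R -> V -> V) (act' : R -> V' -> V').
Variable phi : V -> V'.
Variables (L : set V) (N N' : set V').
Hypothesis act'D : forall a x y, act' a (x + y) = act' a x + act' a y.
Hypothesis phiB : {morph phi : x y / x - y}.
Hypothesis phi_act : forall a x, phi (act a x) = act' a (phi x).
Hypotheses (Ls : is_submod act L) (Ns : is_submod act' N) (N's : is_submod act' N').
Hypotheses (NN' : N `<=` N') (LN' : forall x, L x -> N' (phi x)).
Hypothesis phi_onto : forall y, N' y -> exists2 x, L x & N (y - phi x).

(** The correspondence theorem for the isomorphism from L/(L & phi^-1 N) to N'/N. Only surjectivity
    modulo [N] is asked of [phi] on [L], which is what homogeneous components provide. *)
Lemma rel_length_iso k :
  rel_length act (L `&` phi @^-1` N) L k <-> rel_length act' N N' k.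
Proof.
pose f (X : set V) : set V' := [set y | exists2 x, X x & N (y - phi x)].
pose g (Y : set V') : set V := L `&` phi @^-1` Y.
have phi0 : phi 0 = 0 by rewrite -(subrr 0) phiB subrr.
have [N0 NB Na] := Ns; have [L0 LB La] := Ls.
have fS X Y : X `<=` Y -> f X `<=` f Y by move=> XY y [x /XY Yx Nx]; exists x.
have gS X Y : X `<=` Y -> g X `<=` g Y by move=> XY x [Lx /XY].
have Cf X : [/\ is_submod act X, L `&` phi @^-1` N `<=` X & X `<=` L] ->
    [/\ is_submod act' (f X), N `<=` f X & f X `<=` N'].
  move=> [[X0 XB Xa] LX XL]; split; first split.
  - by exists 0; rewrite // phi0 subr0.
  - move=> y z [x Xx Nx] [w Xw Nw]; exists (x - w); first exact: XB.
    have -> : y - z - phi (x - w) = (y - phi x) - (z - phi w); last exact: NB.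
    by rewrite phiB !opprB addrACA [RHS]addrACA [- z - _]addrC.
  - move=> a y [x Xx Nx]; exists (act a x); first exact: Xa.
    have -> : act' a y - phi (act a x) = act' a (y - phi x); last exact: Na.
    by rewrite phi_act -[y in LHS](subrK (phi x)) act'D addrK.
  - by move=> y Ny; exists 0; rewrite // phi0 subr0.
  - move=> y [x /XL/LN' N'x /NN' N'y]; rewrite -(subrK (phi x) y).
    exact: (submodD N's).
have Cg Y : [/\ is_submod act' Y, N `<=` Y & Y `<=` N'] ->
    [/\ is_submod act (g Y), L `&` phi @^-1` N `<=` g Y & g Y `<=` L].
  move=> [[Y0 YB Ya] NY YN']; split; first split.
  - by split; rewrite // /preimage /= phi0.
  - move=> x z [Lx Yx] [Lz Yz]; split; first exact: LB.
    by rewrite /preimage /= phiB; exact: YB.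
  - move=> a x [Lx Yx]; split; first exact: La.
    by rewrite /preimage /= phi_act; exact: Ya.
  - by move=> x [Lx /NY].
  - by move=> x [].
have fK X : [/\ is_submod act X, L `&` phi @^-1` N `<=` X & X `<=` L] -> g (f X) = X.
  move=> [Xs LX XL]; apply/seteqP; split=> x.
    move=> [Lx [z Xz Nz]]; rewrite -(subrK z x); apply: (submodD Xs) => //.
    by apply: LX; split; [apply: LB => //; exact: XL|rewrite /preimage /= phiB].
  by move=> Xx; split; [exact: XL|exists x; rewrite ?subrr].
have gK Y : [/\ is_submod act' Y, N `<=` Y & Y `<=` N'] -> f (g Y) = Y.
  move=> [Ys NY YN']; apply/seteqP; split=> y.
    by move=> [x [Lx Yx] /NY Yyx]; rewrite -(subrK (phi x) y); exact: (submodD Ys).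
  move=> Yy; have [x Lx Nyx] := phi_onto (YN' _ Yy); exists x => //; split=> //.
  rewrite /preimage /=; have -> : phi x = y - (y - phi x) by rewrite opprB addrC subrK.
  by case: Ys => _ YB _; apply: YB => //; exact: NY.
by split; [apply: (max_chain_iso (f := f) (g := g))|apply: (max_chain_iso (f := g) (g := f))].
Qed.

End LengthIso.

(** * Noetherian rings and modules *)

Section Stabilization.
Variables (T : Type) (le : T -> T -> Prop) (C : set T).

(** Order and class are parameters so that ascending chains of submodules and descending chains of
    ideals share [stabilizes_max]. *)
Definition stabilizes : Prop := forall F : nat -> T, (forall i, C (F i)) ->
  (forall i, le (F i) (F i.+1)) -> exists k, forall i, (k <= i)%N -> F i = F k.

Lemma stabilizes_max (D : set T) (x0 : T) : stabilizes -> D `<=` C -> D x0 ->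
  exists x, D x /\ forall y, D y -> le x y -> y = x.
Proof.
move=> st DC Dx0; apply: contrapT => nomax.
have next (x : {x | D x}) : exists y : {x | D x},
    le (projT1 x) (projT1 y) /\ projT1 y <> projT1 x.
  case: x => x Dx; apply: contrapT => nonext; apply: nomax; exists x; split=> // y Dy xy.
  by apply: contrapT => yx; apply: nonext; exists (exist _ y Dy).
have /choice[f Hf] := next.
pose F i := iter i f (exist _ x0 Dx0).
have [k Hk] := st (fun i => projT1 (F i)) (fun i => DC _ (projT2 (F i)))
  (fun i => proj1 (Hf (F i))).
exact: (proj2 (Hf (F k))) (Hk k.+1 (leqnSn k)).
Qed.

End Stabilization.

Lemma chain_homo (T : Type) (F : nat -> set T) : (forall i, F i `<=` F i.+1) ->
  forall i j, (i <= j)%N -> F i `<=` F j.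
Proof.
move=> FS i j /subnK <-; elim: (j - i)%N => [|m IHm]; first by [].
by rewrite addSn; apply: subset_trans IHm (FS _).
Qed.

Section Noetherian.
Variables (R : Type) (V : zmodType) (act : R -> V -> V).

Definition noeth (L : set V) : Prop :=
  stabilizes (fun X Y : set V => X `<=` Y) [set K | is_submod act K /\ K `<=` L].

(** A chain is controlled by its traces on [K] and its images modulo [K]; the latter are expressed
    elementwise to avoid quotients. *)
Lemma stab_glue (F : nat -> set V) (K : set V) (k1 k2 : nat) :
  (forall i, is_submod act (F i)) -> (forall i, F i `<=` F i.+1) ->
  (forall i, (k1 <= i)%N -> F i `&` K = F k1 `&` K) ->
  (forall i y, (k2 <= i)%N -> F i y -> exists2 z, F k2 z & K (y - z)) ->
  exists k, forall i, (k <= i)%N -> F i = F k.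
Proof.
move=> Fs FS stI stQ; have le := chain_homo FS.
exists (maxn k1 k2) => i; rewrite geq_max => /andP[k1i k2i].
apply/seteqP; split; last by apply: le; rewrite geq_max k1i.
move=> y Fy; have [z Fz Kyz] := stQ i y k2i Fy.
rewrite -(subrK z y); apply: (submodD (Fs _)); last exact: le (leq_maxr _ _) _ Fz.
have : (F i `&` K) (y - z).
  by split=> //; case: (Fs i) => _ FB _; apply: FB => //; exact: le k2i _ Fz.
by rewrite stI // => -[Fyz _]; exact: le (leq_maxl _ _) _ Fyz.
Qed.

End Noetherian.

Notation noeth_ring A := (noeth (fun a x : A => a * x) setT).

(** * Commutative Artinian rings are Noetherian *)

Section Artinian.
Variable A : comNzRingType.
Hypothesis hA : artinian A.

Lemma artinian_expr (a : A) : exists k c, a ^+ k = a ^+ k.+1 * c.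
Proof.
pose F i : set A := [set x | exists c, x = a ^+ i * c].
have Fs i : is_ideal (F i).
  split; first by exists 0; rewrite mulr0.
    by move=> _ _ [c ->] [c' ->]; exists (c - c'); rewrite mulrBr.
  by move=> b _ [c ->]; exists (b * c); rewrite mulrCA.
have [|k Hk] := hA Fs.
  by move=> i _ [c ->]; exists (a * c); rewrite exprSr mulrA.
exists k; suff : F k.+1 (a ^+ k) by [].
by rewrite Hk //; exists 1; rewrite mulr1.
Qed.

(* Among the ideals that are not Noetherian modules a minimal one would be a
   vector space over the field [A / Ann I] all of whose proper subspaces are
   finite-dimensional. *)
Lemma artinian_noeth : noeth_ring A.
Proof.
pose mu := fun a x : A => a * x.
pose nn := [set I : set A | is_ideal I /\ ~ noeth mu I].
apply: contrapT => nA.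
have nnT : nn setT by split.
have hA' : stabilizes (fun X Y : set A => Y `<=` X) [set I | is_ideal I].
  by move=> F FI FS; exact: hA.
have nnC : nn `<=` [set I | is_ideal I] by move=> J [].
have [I [[Is nI] Imin]] := stabilizes_max hA' nnC nnT.
have ltI J : is_ideal J -> J `<=` I -> J <> I -> noeth mu J.
  by move=> Js JI ne; apply: contrapT => nJ; apply: ne; apply: Imin.
have [I0 IB Ia] := Is.
(* If kernel and image of multiplication by [a] on [I] were both proper in [I], both would be
   Noetherian by minimality, and [I] would be too, by gluing. *)
have aI a : (forall x, I x -> a * x = 0) \/ forall x, I x -> exists2 y, I y & x = a * y.
  pose K := [set x | I x /\ a * x = 0]; pose aI := [set x | exists2 y, I y & x = a * y].
  have Ks : is_ideal K.
    split; first by rewrite /K /= mulr0.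
      by move=> x y [Ix x0] [Iy y0]; split; [exact: IB|rewrite mulrBr x0 y0 subr0].
    by move=> b x [Ix x0]; split; [exact: Ia|rewrite mulrCA x0 mulr0].
  have aIs : is_ideal aI.
    split; first by exists 0; rewrite ?mulr0.
      by move=> _ _ [x Ix ->] [y Iy ->]; exists (x - y); [exact: IB|rewrite mulrBr].
    by move=> b _ [x Ix ->]; exists (b * x); [exact: Ia|rewrite mulrCA].
  have [KI|neK] := pselect (K = I); first by left=> x; rewrite -KI => -[].
  have [aII|neaI] := pselect (aI = I); first by right=> x; rewrite -{1}aII.
  exfalso; apply: nI => F FI FS.
  have nK := ltI _ Ks (fun x => @proj1 _ _) neK.
  have naI : noeth mu aI by apply: (ltI _ aIs) => // _ [x Ix ->]; exact: Ia.
  have [k1 Hk1] := nK (fun i => F i `&` K)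
    (fun i => conj (is_submodI (proj1 (FI i)) Ks) (fun x => @proj2 _ _))
    (fun i => setSI (FS i)).
  have [k2 Hk2] : exists k, forall i, (k <= i)%N ->
      [set x | exists2 y, F i y & x = a * y] = [set x | exists2 y, F k y & x = a * y].
    apply: naI => i; last by move=> _ [y Fy ->]; exists y => //; exact: FS.
    have [[F0 FB Fa] FsubI] := FI i; split; last by move=> _ [y /FsubI Iy ->]; exists y.
    split; first by exists 0; rewrite ?mulr0.
      by move=> _ _ [x Fx ->] [y Fy ->]; exists (x - y); [exact: FB|rewrite mulrBr].
    by move=> b _ [x Fx ->]; exists (b * x); [exact: Fa|rewrite mulrCA].
  apply: (stab_glue (act := mu) (K := K) (k1 := k1) (k2 := k2)) => //.
    by move=> i; case: (FI i).
  move=> i y k2i Fy; have [z Fz e] : [set x | exists2 y, F k2 y & x = a * y] (a * y).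
    by rewrite -(Hk2 i k2i); exists y.
  exists z => //; split; last by rewrite mulrBr e subrr.
  by apply: IB; [case: (FI i) => _; apply|case: (FI k2) => _; apply].
pose q : set A := [set a | forall x, I x -> a * x = 0].
(* From aI = I follows a^k I = I, and a^k = a^(k+1) c makes 1 - a c kill a^k I. Thus A/q is a
   field. *)
have qinv a : ~ q a -> exists b, q (1 - a * b).
  case: (aI a) => [//|aII _]; have [k [c akc]] := artinian_expr a.
  have {aII} akI j : forall x, I x -> exists2 y, I y & x = a ^+ j * y.
    elim: j => [|j IHj] x Ix; first by exists x; rewrite ?mul1r.
    have [y /aII[z Iz ->] ->] := IHj x Ix; by exists z; rewrite // exprSr mulrA.
  exists c => x /(akI k)[y Iy ->].
  by rewrite mulrA mulrBl mul1r mulrAC -exprS -akc subrr mul0r.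
have [F [FI FS Fns]] : exists F : nat -> set A, [/\ forall i, is_ideal (F i) /\ F i `<=` I,
    forall i, F i `<=` F i.+1 & forall k, exists2 i, (k <= i)%N & F i <> F k].
  apply: contrapT => noF; apply: nI => F FI FS; apply: contrapT => ns.
  apply: noF; exists F; split=> // k; apply: contrapT => nk; apply: ns; exists k => i ki.
  by apply: contrapT => ne; apply: nk; exists i.
have le := chain_homo FS.
have step k : exists p : nat * A, [/\ (k <= p.1)%N, F p.1 p.2 & ~ F k p.2].
  have [i ki ne] := Fns k; apply: contrapT => nstep; apply: ne.
  apply/seteqP; split; last exact: le.
  by move=> x Fx; apply: contrapT => nFx; apply: nstep; exists (i, x).
have /choice[nxt Hnxt] := step.
pose idx i := iter i (fun k => (nxt k).1) 0%N.
pose u i := (nxt (idx i)).2.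
have uF i : F (idx i.+1) (u i) by case: (Hnxt (idx i)).
have uNF i : ~ F (idx i) (u i) by case: (Hnxt (idx i)).
have idxS i : (idx i <= idx i.+1)%N by case: (Hnxt (idx i)).
have uI i : I (u i) by case: (FI (idx i.+1)) => _; apply.
(* [W m] is the span of u_1, ..., u_m; u_0 is left out so that the union [UW] is a proper subspace
   of [I]. *)
pose W := fix W m : set A := if m is m'.+1 then
  [set x | exists w c, W m' w /\ x = w + c * u m] else [set 0].
have Ws m : is_ideal (W m).
  elim: m => [|m [W0 WB Wa]].
    split=> //= [_ _ -> ->|b _ ->]; [exact: subr0|exact: mulr0].
  split; first by exists 0, 0; rewrite mul0r addr0.
    move=> _ _ [w [c [Ww ->]]] [w' [c' [Ww' ->]]]; exists (w - w'), (c - c').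
    by split; [exact: WB|rewrite mulrBl opprD addrACA].
  move=> b _ [w [c [Ww ->]]]; exists (b * w), (b * c).
  by split; [exact: Wa|rewrite mulrDr mulrA].
have WS m : W m `<=` W m.+1 by move=> w Ww; exists w, 0; rewrite mul0r addr0.
have Wle := chain_homo WS.
have WF m : W m `<=` F (idx m.+1).
  elim: m => [|m IHm]; first by move=> _ ->; case: (FI (idx 1)) => -[].
  move=> _ [w [c [Ww ->]]]; have [[F0 FB Fa] _] := FI (idx m.+2).
  by apply: (submodD (proj1 (FI _))); [exact: le (IHm _ Ww)|apply: Fa; exact: uF].
(* In a relation u_0 = w + c u_(m+1) either [c] kills [I] and the term drops, or [c] is invertible
   modulo [q] and u_(m+1) would already lie in the earlier member of the chain. *)
have nWu0 m : ~ W m (u 0%N).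
  elim: m => [|m IHm] /=.
    by move=> u0; apply: (uNF 0%N); rewrite u0; case: (FI (idx 0)) => -[].
  move=> [w [c [Ww e]]]; have [qc|/qinv[b qb]] := pselect (q c).
    by apply: IHm; rewrite e qc // addr0.
  apply: (uNF m.+1); have [[F0 FB Fa] _] := FI (idx m.+1).
  have -> : u m.+1 = b * (u 0%N - w).
    have := qb (u m.+1) (uI _); rewrite mulrBl mul1r => /eqP; rewrite subr_eq0 => /eqP ->.
    by rewrite e [w + _]addrC addrK; ring.
  apply: (Fa); apply: FB; last exact: WF.
  by apply: (le (idx 1)); [elim: (m) => // j; move/leq_trans; apply|exact: uF].
pose UW : set A := [set x | exists m, W m x].
have UWs : is_ideal UW.
  split; first by exists 0%N.
    move=> x y [m Wx] [m' Wy]; exists (maxn m m'); case: (Ws (maxn m m')) => _ WB _.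
    by apply: WB; [exact: Wle (leq_maxl _ _) _ Wx|exact: Wle (leq_maxr _ _) _ Wy].
  by move=> b x [m Wx]; exists m; case: (Ws m) => _ _; apply.
have UWI : UW `<=` I by move=> x [m /WF]; case: (FI (idx m.+1)) => _; apply.
have neW : UW <> I by move=> e; have : UW (u 0%N) by [rewrite e]; case=> m; exact: nWu0.
have [k Hk] := ltI _ UWs UWI neW (fun i => UW `&` F (idx i))
  (fun i => conj (is_submodI UWs (proj1 (FI _))) (fun x => @proj1 _ _))
  (fun i => setIS (le _ _ (idxS i))).
(* [UW] is Noetherian by minimality of [I], yet its traces on the chain still grow at every stage
   because of u_(k+1). *)
apply: (uNF k.+1); have : (UW `&` F (idx k.+2)) (u k.+1).
  by split; [exists k.+1, 0, 1; rewrite mul1r add0r; split=> //; case: (Ws k)|exact: uF].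
rewrite Hk; last by rewrite -addn2 leq_addr.
by move=> [_]; exact: le (idxS k) _.
Qed.

End Artinian.

(** * Hilbert's basis theorem *)

Section Hilbert.
Variable R : comNzRingType.
Hypothesis nR : noeth_ring R.

Definition lead_ideal (d : nat) (J : set {poly R}) : set R :=
  [set c | exists p, [/\ J p, (size p <= d.+1)%N & p`_d = c]].

Lemma lead_ideal_submod d J : is_ideal J -> is_ideal (lead_ideal d J).
Proof.
move=> [J0 JB Ja]; split; first by exists 0; rewrite size_poly0 coef0.
  move=> _ _ [p [Jp sp <-]] [q [Jq sq <-]]; exists (p - q).
  rewrite coefB; split=> //; first exact: JB.
  by rewrite (leq_trans (size_polyD _ _)) // size_polyN geq_max sp.
move=> a _ [p [Jp sp <-]]; exists (a%:P * p); rewrite coefCM; split=> //.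
  exact: Ja.
by rewrite mul_polyC (leq_trans (size_scale_leq _ _)).
Qed.

Lemma lead_idealS d J J' : is_ideal J -> J `<=` J' -> lead_ideal d J `<=` lead_ideal d.+1 J'.
Proof.
move=> [_ _ Ja] JJ' _ [p [Jp sp <-]]; exists ('X * p); rewrite coefXM /=; split=> //.
  exact/JJ'/Ja.
by rewrite (leq_trans (size_polyMleq _ _)) // size_polyX.
Qed.

Lemma lead_ideal_sub d J J' : J `<=` J' -> lead_ideal d J `<=` lead_ideal d J'.
Proof. by move=> JJ' _ [p [/JJ' Jp sp <-]]; exists p. Qed.

(** The diagonal chain [lead_ideal i (F i)] stabilizes, which settles all large degrees at once; the
    finitely many small degrees are treated one by one. Equality of leading ideals then gives
    equality of the members by cancelling top coefficients, by induction on the size. *)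
Lemma hilbert_basis : noeth_ring {poly R}.
Proof.
move=> F FT FS; have Fs i : is_ideal (F i) by case: (FT i).
have le := chain_homo FS.
have Ls d i : is_ideal (lead_ideal d (F i)) by exact: lead_ideal_submod.
have [k Hk] := nR (fun i => conj (Ls i i) (@subsetT _ _))
  (fun i => lead_idealS (d := i) (Fs i) (FS i)).
have {}Hk i : (k <= i)%N -> lead_ideal i (F i) = lead_ideal k (F k) by exact: Hk.
have stab d : exists n, forall i, (n <= i)%N -> lead_ideal d (F i) = lead_ideal d (F n).
  exact: (nR (fun i => conj (Ls d i) (@subsetT _ _))
    (fun i => lead_ideal_sub (d := d) (FS i))).
have [N HN] : exists N, forall d i, (d < k)%N -> (N <= i)%N ->
    lead_ideal d (F i) = lead_ideal d (F N).
  elim: (k) => [|m [N HN]]; first by exists 0%N.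
  have [n Hn] := stab m; exists (maxn N n) => d i.
  rewrite ltnS leq_eqVlt geq_max => /orP[/eqP->|dm] /andP[Ni ni].
    by rewrite (Hn i) // [RHS](Hn _) ?leq_maxr.
  by rewrite (HN d i) // [RHS](HN d) ?leq_maxl.
(* The left side embeds in a diagonal term beyond [k], which equals [lead_ideal k (F k)], and
   multiplication by powers of X brings this back to degree [d]. *)
have Hd d i j : (k <= d)%N -> (k <= i)%N -> (k <= j)%N ->
    lead_ideal d (F i) `<=` lead_ideal d (F j).
  move=> kd ki kj; have dom m : (d <= m)%N -> lead_ideal d (F i) `<=` lead_ideal m (F i).
    move=> /subnK <-; elim: (m - d)%N => // l IHl.
    by rewrite addSn; apply: subset_trans IHl _; exact: lead_idealS.
  have domk m : (k <= m)%N -> lead_ideal k (F k) `<=` lead_ideal m (F k).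
    move=> /subnK <-; elim: (m - k)%N => // l IHl.
    by rewrite addSn; apply: subset_trans IHl _; exact: lead_idealS.
  apply: subset_trans (dom (maxn d i) (leq_maxl _ _)) _.
  apply: subset_trans (lead_ideal_sub (le i (maxn d i) (leq_maxr _ _))) _.
  rewrite Hk; last by rewrite (leq_trans ki) // leq_maxr.
  apply: subset_trans (domk _ kd) _; exact: lead_ideal_sub (le _ _ kj).
exists (maxn N k) => i; rewrite geq_max => /andP[Ni ki].
apply/seteqP; split; last by apply: le; rewrite geq_max Ni.
move=> p; have [s] := ubnP (size p); elim: s p => // s IHs p ps Fp.
have [->|p0] := eqVneq p 0; first by case: (Fs (maxn N k)).
have sp : (size p).-1.+1 = size p by rewrite prednK // size_poly_gt0.
have : lead_ideal (size p).-1 (F (maxn N k)) (lead_coef p).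
  have Lp : lead_ideal (size p).-1 (F i) (lead_coef p) by exists p; rewrite sp.
  case: (ltnP (size p).-1 k) => [lt|ge].
    by rewrite (HN _ _ lt (leq_maxl _ _)) -(HN _ i lt).
  by apply: (Hd _ i) => //; exact: leq_maxr.
move=> [q [Fq sq cq]]; rewrite -(subrK q p); apply: (submodD (Fs _)) => //.
apply: IHs; last first.
  by case: (Fs i) => _ FB _; apply: FB => //; apply: le Fq; rewrite geq_max Ni.
rewrite -ltnS (leq_trans _ ps) // ltnS -sp ltnS.
apply/leq_sizeP => j; rewrite leq_eqVlt coefB => /orP[/eqP<-|lt].
  by rewrite cq lead_coefE subrr.
rewrite !nth_default ?subrr //; first by rewrite (leq_trans sq).
by rewrite -sp.
Qed.

End Hilbert.

Lemma noeth_ring_surj (R S : comNzRingType) (f : {rmorphism R -> S}) :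
  noeth_ring R -> (forall y, exists x, y = f x) -> noeth_ring S.
Proof.
move=> nR fsurj F FT FS.
have [k Hk] : exists k, forall i, (k <= i)%N -> f @^-1` F i = f @^-1` F k.
  apply: nR => i; last by move=> x; exact: FS.
  have [[F0 FB Fa] _] := FT i; split=> //; split; first by rewrite /preimage /= rmorph0.
    by move=> x y Fx Fy; rewrite /preimage /= rmorphB; exact: FB.
  by move=> a x Fx; rewrite /preimage /= rmorphM; exact: Fa.
exists k => i ki; apply/seteqP; split=> y; have [x ->] := fsurj y => Fx.
  by have : (f @^-1` F i) x by []; rewrite Hk.
by have : (f @^-1` F k) x by []; rewrite -(Hk i).
Qed.

(** [R'] is an iterated polynomial ring over [R]; leaving it existential allows an induction on [s]
    with one variable at a time. *)
Lemma noeth_adjoin (R S : comNzRingType) (f : {rmorphism R -> S}) (s : seq S) :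
  noeth_ring R -> exists (R' : comNzRingType) (f' : {rmorphism R' -> S}),
  [/\ noeth_ring R', range f `<=` range f' & forall x, x \in s -> range f' x].
Proof.
elim: s R f => [|x s IHs] R f nR; first by exists R, f; split.
have cfx : commr_rmorph f x by move=> a; exact: mulrC.
pose g : {rmorphism {poly R} -> S} := horner_morph cfx.
have [R' [f' [nR' gf' sf']]] := IHs _ g (hilbert_basis nR).
exists R', f'; split=> //.
  by move=> _ [a _ <-]; apply: gf'; exists a%:P => //; rewrite /g /= horner_morphC.
move=> y; rewrite inE => /orP[/eqP->|/sf' //].
by apply: gf'; exists 'X => //; rewrite /g /= horner_morphX.
Qed.

Definition adjoin (B : comNzRingType) (M : lmodType B) (N : set M) (g : M) : set M :=
  [set x | exists y b, N y /\ x = y + b *: g].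

Section NoetherianModules.
Variables (B : comNzRingType) (M : lmodType B).
Hypothesis nB : noeth_ring B.
Let act := fun (b : B) (x : M) => b *: x.

Lemma is_submod_adjoin (N : set M) (g : M) : is_submod act N -> is_submod act (adjoin N g).
Proof.
move=> [N0 NB Na]; split; first by exists 0, 0; rewrite scale0r addr0.
  move=> _ _ [y [b [Ny ->]]] [z [c [Nz ->]]]; exists (y - z), (b - c).
  by split; [exact: NB|rewrite scalerBl opprD addrACA].
move=> a _ [y [b [Ny ->]]]; exists (a *: y), (a * b).
by split; [exact: Na|rewrite /act scalerDr scalerA].
Qed.

Lemma sub_adjoin (N : set M) (g : M) : N `<=` adjoin N g.
Proof. by move=> x Nx; exists x, 0; rewrite scale0r addr0. Qed.

Lemma mem_adjoin (N : set M) (g : M) : N 0 -> adjoin N g g.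
Proof. by move=> N0; exists 0, 1; rewrite add0r scale1r. Qed.

(** Modulo [N] the chain is governed by the ideals of those [b] for which the coset N + b g meets
    [F i]. *)
Lemma noeth_adjoin_vector (N : set M) (g : M) : is_submod act N -> noeth act N ->
  noeth act (adjoin N g).
Proof.
move=> Ns nN F FI FS; have Fs i : is_submod act (F i) by case: (FI i).
have [k1 Hk1] := nN (fun i => F i `&` N)
  (fun i => conj (is_submodI (Fs i) Ns) (fun x => @proj2 _ _)) (fun i => setSI (FS i)).
have [N0 NB Na] := Ns.
have [k2 Hk2] : exists k, forall i, (k <= i)%N ->
    [set b | exists2 y, N y & F i (y + b *: g)] = [set b | exists2 y, N y & F k (y + b *: g)].
  apply: nB => i; last by move=> b [y Ny Fy]; exists y => //; exact: FS.
  have [F0 FB Fa] := Fs i; split=> //; split.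
  - by exists 0; rewrite // scale0r addr0.
  - move=> a b [x Nx Fx] [y Ny Fy]; exists (x - y); first exact: NB.
    by rewrite scalerBl addrACA -opprD; exact: FB.
  - move=> a b [x Nx Fx]; exists (a *: x); first exact: Na.
    by rewrite -scalerA -scalerDr; exact: Fa.
apply: (stab_glue (act := act) (K := N) (k1 := k1) (k2 := k2)) => // i x k2i Fx.
have [_ /(_ _ Fx)[y [b [Ny e]]]] := FI i.
have : [set b | exists2 y, N y & F i (y + b *: g)] b by exists y; rewrite // -e.
rewrite Hk2 // => -[z Nz Fz]; exists (z + b *: g) => //.
by rewrite e opprD addrACA subrr addr0; exact: NB.
Qed.

Lemma noeth_fin_gen : fin_gen M -> noeth act setT.
Proof.
move=> [k [g gen]].
suff [N [Ns nN gN]] : exists N, [/\ is_submod act N, noeth act N & forall i, N (g i)].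
  have NT : N = setT.
    apply/seteqP; split=> // x _; have [c ->] := gen x.
    apply: (submod_sum Ns) => i _; case: Ns => _ _; exact.
  by rewrite -NT.
suff [N [Ns nN gN]] : exists N, [/\ is_submod act N, noeth act N &
    forall x, x \in codom g -> N x].
  by exists N; split=> // i; apply: gN; exact: codom_f.
elim: (codom g) => [|x s [N [Ns nN sN]]].
  exists [set 0]; split=> //.
    by split=> //= [_ _ -> ->|a _ ->]; [exact: subr0|exact: scaler0].
  move=> F FI _; have F0 i : F i = [set 0].
    by have [[F0 _ _] FI0] := FI i; apply/seteqP; split=> // _ ->.
  by exists 0%N => i _; rewrite !F0.
have [N0 _ _] := Ns.
exists (adjoin N x); split.
- exact: is_submod_adjoin.
- exact: noeth_adjoin_vector.
- move=> y; rewrite inE => /orP[/eqP->|/sN Ny].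
    exact: mem_adjoin.
  exact: sub_adjoin.
Qed.

End NoetherianModules.

Lemma standard_graded_noeth (r : nat) (A : comNzRingType) (B : comAlgType A)
    (G : 'rV[int]_r -> set B) :
  artinian A -> standard_graded G -> noeth_ring B.
Proof.
move=> /artinian_noeth nA [_ _ _ [s [_ gen]]].
have [R [f [nR Af sf]]] := noeth_adjoin (in_alg B) s nA.
apply: (noeth_ring_surj (f := f) nR) => y.
suff /asboolP[x _ <-] : y \in [pred y : B | `[< range f y >]] by exists x.
apply: gen => [|x /sf fx]; last by apply/asboolP.
split; first by apply/asboolP; exists 1 => //; rewrite rmorph1.
  move=> a _ _ /asboolP[x _ <-] /asboolP[z _ <-]; apply/asboolP.
  have [c _ fc] : range f (in_alg B a) by apply: Af; exists a.
  by exists (c * x + z) => //; rewrite rmorphD rmorphM fc /= mulr_algl.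
move=> _ _ /asboolP[x _ <-] /asboolP[z _ <-]; apply/asboolP.
by exists (x * z) => //; rewrite rmorphM.
Qed.

(** * Graded modules *)

Section LexOrder.
Variable r : nat.
Implicit Types u v w : 'rV[int]_r.

(** A translation-invariant total order on Z^r, so that elements have leading components; this
    serves [homog_prime]. *)
Definition lexlt u v : Prop :=
  exists2 i : 'I_r, (forall j : 'I_r, (j < i)%N -> u 0 j = v 0 j) & u 0 i < v 0 i.

Lemma lexlt_irr u : ~ lexlt u u.
Proof. by move=> [i _]; rewrite ltxx. Qed.

Lemma lexlt_trans v u w : lexlt u v -> lexlt v w -> lexlt u w.
Proof.
move=> [i uv lti] [k vw ltk].
case: (ltngtP i k) => [ik|ki|ik].
- exists i; last by rewrite -vw.
  by move=> j ji; rewrite uv // vw // (ltn_trans ji).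
- exists k; last by rewrite uv.
  by move=> j jk; rewrite uv ?vw // (ltn_trans jk).
- have {}ik : i = k by exact: val_inj.
  by subst k; exists i; [move=> j ji; rewrite uv ?vw|exact: lt_trans ltk].
Qed.

Lemma lexlt_add2r w u v : lexlt u v -> lexlt (u + w) (v + w).
Proof.
move=> [i uv lti]; exists i; last by rewrite !mxE ltrD2r.
by move=> j ji; rewrite !mxE uv.
Qed.

Lemma lexlt_total u v : [\/ u = v, lexlt u v | lexlt v u].
Proof.
have [|/existsPn uv] := boolP [exists i, u 0 i != v 0 i]; last first.
  by apply: Or31; apply/rowP => i; apply/eqP; have := uv i; rewrite negbK.
move=> /existsP[i0 ne0].
case: (arg_minnP (P := fun i => u 0 i != v 0 i) (fun i : 'I_r => i : nat) ne0) => i ne imin.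
have eqlt (j : 'I_r) : (j < i)%N -> u 0 j = v 0 j.
  by move=> ji; apply/eqP; apply: contraTT ji => /imin; rewrite -leqNgt.
case: (ltgtP (u 0 i) (v 0 i)) ne => // lt _; first by apply: Or32; exists i.
by apply: Or33; exists i => // j /eqlt.
Qed.

Lemma lex_max (P : 'rV[int]_r -> Prop) (s : seq 'rV[int]_r) u0 : u0 \in s -> P u0 ->
  exists m, [/\ m \in s, P m & forall u, u \in s -> P u -> u = m \/ lexlt u m].
Proof.
elim: s u0 => // x s IHs u0 us Pu0.
have [[u' us' Pu']|none] := pselect (exists2 u', u' \in s & P u').
  have [m [ms Pm mmax]] := IHs _ us' Pu'.
  have [[Px mx]|nx] := pselect (P x /\ lexlt m x).
    exists x; split=> //; first by rewrite mem_head.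
    move=> u; rewrite inE => /orP[/eqP-> _|uS Pu]; first by left.
    right; case: (mmax u uS Pu) => [->//|um]; exact: lexlt_trans mx.
  exists m; split=> //; first by rewrite inE ms orbT.
  move=> u; rewrite inE => /orP[/eqP-> Px|]; last exact: mmax.
  by case: (lexlt_total x m) => [->|lt|lt]; [left|right|case: nx].
move: us; rewrite inE => /orP[/eqP ux|us]; last by case: none; exists u0.
exists x; rewrite mem_head; split=> //; first by rewrite -ux.
move=> u; rewrite inE => /orP[/eqP->|us] Pu; first by left.
by case: none; exists u.
Qed.

End LexOrder.

(** * Homogeneous components *)

Section Components.
Variables (r : nat) (V : zmodType) (G : 'rV[int]_r -> set V).
Hypothesis hG : is_grading G.
Implicit Types (x y : V) (nu mu : 'rV[int]_r).

Lemma grading0 nu : G nu 0.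
Proof. by case: hG => /(_ nu)[]. Qed.

Lemma gradingB nu x y : G nu x -> G nu y -> G nu (x - y).
Proof. by case: hG => /(_ nu)[_ +] _ _; apply. Qed.

Lemma gradingD nu x y : G nu x -> G nu y -> G nu (x + y).
Proof.
move=> Gx Gy; rewrite -[y]opprK; apply: gradingB => //.
by rewrite -sub0r; apply: gradingB => //; exact: grading0.
Qed.

Lemma gcomp_subproof x : exists c : 'rV[int]_r -> V, (forall nu, G nu (c nu)) /\
  exists s, [/\ uniq s, forall nu, nu \notin s -> c nu = 0 & x = \sum_(nu <- s) c nu].
Proof.
case: (hG) => _ /(_ x)[s [f [Gf ->]]] _.
(* The given list may repeat degrees, so equal degrees are collected first. *)
exists (fun nu => \sum_(mu <- s | mu == nu) f mu); split.
  move=> nu; elim/big_ind: _ => [|y z|mu /eqP<-//]; [exact: grading0|exact: gradingD].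
exists (undup s); split; first exact: undup_uniq.
  move=> nu; rewrite mem_undup => ns; rewrite big_seq_cond big1 // => mu /andP[ms /eqP e].
  by rewrite -e ms in ns.
rewrite (exchange_big_dep xpredT) //= big_seq [RHS]big_seq; apply: eq_bigr => mu ms.
rewrite big_mkcond (bigD1_seq mu) ?undup_uniq ?mem_undup //= eqxx big1 ?addr0 // => nu.
by rewrite eq_sym => /negbTE ->.
Qed.

Definition gcomp x : 'rV[int]_r -> V := projT1 (cid (gcomp_subproof x)).

Lemma gcomp_in x nu : G nu (gcomp x nu).
Proof. by rewrite /gcomp; case: cid => c []. Qed.

Lemma gcomp_sum x : exists s,
  [/\ uniq s, forall nu, nu \notin s -> gcomp x nu = 0 & x = \sum_(nu <- s) gcomp x nu].
Proof. by rewrite /gcomp; case: cid => c []. Qed.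

Lemma sum_supp_widen (c : 'rV[int]_r -> V) (s t : seq 'rV[int]_r) :
  uniq s -> uniq t -> {subset s <= t} -> (forall nu, nu \notin s -> c nu = 0) ->
  \sum_(nu <- s) c nu = \sum_(nu <- t) c nu.
Proof.
move=> us ut st c0; rewrite [RHS](bigID (mem s)) /= [X in _ + X]big1 ?addr0;
  last by move=> nu /c0.
rewrite -[RHS]big_filter; apply: perm_big; apply: uniq_perm; rewrite ?filter_uniq //.
move=> nu; rewrite mem_filter /=; apply/idP/andP => [ns|[]//].
  by split; [exact: ns|exact: st].
Qed.

Lemma gcomp_eq x (c : 'rV[int]_r -> V) (s : seq 'rV[int]_r) :
  (forall nu, G nu (c nu)) -> uniq s -> (forall nu, nu \notin s -> c nu = 0) ->
  x = \sum_(nu <- s) c nu -> gcomp x = c.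
Proof.
move=> Gc us c0 xE; have [t [ut t0 xE']] := gcomp_sum x.
pose w := undup (s ++ t); have uw : uniq w by exact: undup_uniq.
have sw : {subset s <= w} by move=> nu ns; rewrite mem_undup mem_cat ns.
have tw : {subset t <= w} by move=> nu ns; rewrite mem_undup mem_cat ns orbT.
have /= w0 := let: And3 _ _ h := hG in h w (fun nu => gcomp x nu - c nu) uw
  (fun nu => gradingB (gcomp_in x nu) (Gc nu)).
apply/funext => nu; have [nw|] := boolP (nu \in w).
  apply/eqP; rewrite -subr_eq0; apply/eqP; apply: w0 => //.
  by rewrite sumrB -(sum_supp_widen us uw sw c0) -(sum_supp_widen ut uw tw t0) -xE -xE' subrr.
by rewrite mem_undup mem_cat negb_or => /andP[/c0 -> /t0].
Qed.

Lemma gcomp0 nu : gcomp 0 nu = 0.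
Proof.
by rewrite (@gcomp_eq 0 (fun=> 0) [::]) ?big_nil // => mu; exact: grading0.
Qed.

Lemma gcompD x y nu : gcomp (x + y) nu = gcomp x nu + gcomp y nu.
Proof.
have [s [us s0 xE]] := gcomp_sum x; have [t [ut t0 yE]] := gcomp_sum y.
pose w := undup (s ++ t); have uw : uniq w by exact: undup_uniq.
have sw : {subset s <= w} by move=> mu ns; rewrite mem_undup mem_cat ns.
have tw : {subset t <= w} by move=> mu ns; rewrite mem_undup mem_cat ns orbT.
rewrite (@gcomp_eq (x + y) (fun nu => gcomp x nu + gcomp y nu) w) //.
- by move=> mu; apply: gradingD; exact: gcomp_in.
- by move=> mu; rewrite mem_undup mem_cat negb_or => /andP[/s0 -> /t0 ->]; rewrite addr0.
- by rewrite big_split /= -(sum_supp_widen us uw sw s0) -(sum_supp_widen ut uw tw t0) -xE -yE.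
Qed.

Lemma gcomp_bigsum (I : Type) (s : seq I) (F : I -> V) nu :
  gcomp (\sum_(i <- s) F i) nu = \sum_(i <- s) gcomp (F i) nu.
Proof. by elim/big_rec2: _ => [|i x y _ <-]; [exact: gcomp0|exact: gcompD]. Qed.

Lemma gcomp_homog x del nu : G del x -> gcomp x nu = if nu == del then x else 0.
Proof.
move=> Gx; rewrite (@gcomp_eq x (fun nu => if nu == del then x else 0) [:: del]) //.
- by move=> mu; case: eqP => [->|_] //; exact: grading0.
- by move=> mu; rewrite inE => /negbTE ->.
- by rewrite big_seq1 eqxx.
Qed.

End Components.

Definition hom_set (r : nat) (V : zmodType) (G : 'rV[int]_r -> set V)
    (hG : is_grading G) (N : set V) : Prop :=
  forall x nu, N x -> N (gcomp hG x nu).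

Section GradedModules.
Variables (r : nat) (B : comNzRingType) (G : 'rV[int]_r -> set B).
Hypothesis hG : is_grading G.
Hypothesis GM : forall mu nu a b, G mu a -> G nu b -> G (mu + nu) (a * b).
Variables (M : lmodType B) (H : 'rV[int]_r -> set M).
Hypothesis hH : is_grading H.
Hypothesis HM : forall mu nu b x, G mu b -> H nu x -> H (mu + nu) (b *: x).

Local Notation submod := (is_submod (fun (b : B) (x : M) => b *: x)).

Lemma gcomp_scale_homog b y del mu : H del y ->
  gcomp hH (b *: y) (mu + del) = gcomp hG b mu *: y.
Proof.
move=> Hy; have [s [us s0 bE]] := gcomp_sum hG b.
rewrite (@gcomp_eq _ _ _ hH _ (fun nu => gcomp hG b (nu - del) *: y) [seq nu + del | nu <- s]).
- by rewrite addrK.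
- by move=> nu; rewrite -[nu in H nu](subrK del); apply: HM => //; exact: gcomp_in.
- by rewrite map_inj_uniq //; exact: addIr.
- move=> nu ns; rewrite s0 ?scale0r //; apply: contra ns => ns.
  by apply/mapP; exists (nu - del); rewrite ?subrK.
- rewrite big_map {1}bE scaler_suml; apply: eq_bigr => nu _.
  by rewrite addrK.
Qed.

Lemma gcomp_homog_scale a x al nu : G al a ->
  gcomp hH (a *: x) (al + nu) = a *: gcomp hH x nu.
Proof.
move=> Ga; have [s [us s0 xE]] := gcomp_sum hH x.
rewrite (@gcomp_eq _ _ _ hH _ (fun nu => a *: gcomp hH x (nu - al)) [seq al + nu | nu <- s]).
- by rewrite addrC addKr.
- move=> mu; rewrite -[mu in H mu](subrK al) [mu - al + al]addrC.
  by apply: HM => //; exact: gcomp_in.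
- by rewrite map_inj_uniq //; exact: addrI.
- move=> mu ns; rewrite s0 ?scaler0 //; apply: contra ns => ns.
  by apply/mapP; exists (mu - al); rewrite // addrC subrK.
- rewrite big_map {1}xE scaler_sumr; apply: eq_bigr => mu _.
  by rewrite addrC addKr.
Qed.

Lemma hom_set_colon N y del : submod N -> hom_set hH N -> H del y ->
  hom_set hG [set b | N (b *: y)].
Proof.
by move=> Ns hN Hy b mu /= Nby; rewrite -(gcomp_scale_homog _ _ Hy); exact: hN.
Qed.

Lemma hom_set_adjoin N y del : hom_set hH N -> H del y ->
  hom_set hH (adjoin N y).
Proof.
move=> hN Hy _ nu [z [b [Nz ->]]]; exists (gcomp hH z nu), (gcomp hG b (nu - del)).
split; first exact: hN.
by rewrite gcompD -(gcomp_scale_homog _ _ Hy) subrK.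
Qed.

End GradedModules.

(** * Homogeneous primes as maximal colon ideals *)

Section GradedPrimes.
Variables (r : nat) (B : comNzRingType) (G : 'rV[int]_r -> set B).
Hypothesis hG : is_grading G.
Hypothesis GM : forall mu nu a b, G mu a -> G nu b -> G (mu + nu) (a * b).
Hypothesis nB : noeth_ring B.

(** Let a_m and b_l be the components of largest degree outside [q]. In degree m + l of ab every
    other summand lies in [q]: its first factor does, or has degree below m, and then its second
    factor has degree above l. So a_m b_l is in [q], against the hypothesis for homogeneous a_m. *)
Lemma homog_prime (q : set B) : is_ideal q -> hom_set hG q ->
  (forall al a b, G al a -> q (a * b) -> q a \/ q b) ->
  forall a b, q (a * b) -> q a \/ q b.
Proof.
move=> qs hq qp a b qab; apply: contrapT => /not_orP[nqa nqb].
have GMB : forall mu nu (b : B) (x : B^o), G mu b -> G nu x -> G (mu + nu) (b *: x).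
  exact: GM.
have [q0 qB qM] := qs.
have lead c : ~ q c -> exists m, [/\ ~ q (gcomp hG c m) &
    forall u, ~ q (gcomp hG c u) -> u = m \/ lexlt u m].
  move=> nqc; have [s [us s0 cE]] := gcomp_sum hG c.
  have [u us' nqu] : exists2 u, u \in s & ~ q (gcomp hG c u).
    apply: contrapT => none; apply: nqc; rewrite cE; apply: (submod_sum qs) => u us'.
    by apply: contrapT => nqu; apply: none; exists u.
  have [m [ms Pm mmax]] := lex_max (P := fun u => ~ q (gcomp hG c u)) us' nqu.
  exists m; split=> // v nqv; apply: mmax => //.
  by apply: contrapT => /negP/s0 e; apply: nqv; rewrite e.
have [m [nqm mmax]] := lead a nqa; have [l [nql lmax]] := lead b nqb.
suff : q (gcomp hG a m * gcomp hG b l) by case/(qp _ _ _ (gcomp_in hG a m)).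
have [s [us s0 aE]] := gcomp_sum hG a.
have ms : m \in s by apply: contrapT => /negP/s0 e; apply: nqm; rewrite e.
have := hq _ (m + l) qab; rewrite {1}aE mulr_suml gcomp_bigsum.
have compE u : gcomp hG (gcomp hG a u * b) (m + l) = gcomp hG a u * gcomp hG b (m + l - u).
  have := @gcomp_homog_scale _ _ G B^o G hG GMB _ b _ (m + l - u) (gcomp_in hG a u).
  by rewrite [u + _]addrC subrK.
under eq_bigr => u _ do rewrite compE.
rewrite (bigD1_seq m) //= [m + l]addrC addrK => qsum.
rewrite -[_ * gcomp hG b l](addrK (\sum_(i <- s | i != m) gcomp hG a i * gcomp hG b (l + m - i))).
apply: qB => //; rewrite -big_filter; apply: (submod_sum qs) => u.
rewrite mem_filter => /andP[um _].
have [qu|/mmax [/eqP|um']] := pselect (q (gcomp hG a u)).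
- by rewrite mulrC; exact: qM.
- by rewrite (negbTE um).
- apply: qM; apply: contrapT => /lmax lt.
  have lt1 := lexlt_add2r (l + m - u) um'.
  rewrite [u + _]addrC subrK in lt1.
  case: lt => [e|/(lexlt_add2r m)]; first by move: lt1; rewrite e [m + l]addrC => /lexlt_irr.
  by rewrite [_ + m]addrC => /(lexlt_trans lt1)/lexlt_irr.
Qed.

Variables (M : lmodType B) (H : 'rV[int]_r -> set M).
Hypothesis hH : is_grading H.
Hypothesis HM : forall mu nu b x, G mu b -> H nu x -> H (mu + nu) (b *: x).

Local Notation submod := (is_submod (fun (b : B) (x : M) => b *: x)).

Lemma colon_ideal N (y : M) : submod N -> is_ideal [set b | N (b *: y)].
Proof.
move=> [N0 NB Na]; split; first by rewrite /= scale0r.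
  by move=> a b Nay Nby /=; rewrite scalerBl; exact: NB.
by move=> a b Nby /=; rewrite -scalerA; exact: Na.
Qed.

(** A homogeneous associated prime of M/N: a maximal colon ideal (N : y) with [y] homogeneous
    outside [N]. It is prime because for homogeneous [a] with a y outside [N] the larger ideal (N :
    a y) must equal it. *)
Lemma exists_prime_colon N : submod N -> hom_set hH N -> N <> setT ->
  exists del y (q : spectrum B), [/\ H del y, ~ N y & forall b, q b <-> N (b *: y)].
Proof.
move=> Ns hN NT.
pose D := [set I : set B | exists del y, [/\ H del y, ~ N y & I = [set b | N (b *: y)]]].
have DC : D `<=` [set K | is_ideal K /\ K `<=` setT].
  by move=> _ [del [y [_ _ ->]]]; split=> //; exact: colon_ideal.
have [I0 DI0] : D !=set0.
  have [x nNx] : exists x, ~ N x.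
    by apply: contrapT => /forallNP NN; apply: NT; apply/seteqP; split=> // x _;
      apply: contrapT; exact: NN.
  have [s [us s0 xE]] := gcomp_sum hH x.
  have [u nNu] : exists u, ~ N (gcomp hH x u).
    apply: contrapT => /forallNP NN; apply: nNx; rewrite xE.
    by apply: (submod_sum Ns) => u _; apply: contrapT; exact: NN.
  by exists [set b | N (b *: gcomp hH x u)], u, (gcomp hH x u); split=> //; exact: gcomp_in.
have [I [[del [y [Hy nNy IE]]] Imax]] := stabilizes_max nB DC DI0.
have Is : is_ideal I by rewrite IE; exact: colon_ideal.
have hI : hom_set hG I by rewrite IE; exact: hom_set_colon Ns hN Hy.
have Iprime : forall a b, I (a * b) -> I a \/ I b.
  apply: homog_prime => // al a b Ga Iab.
  have [Ia|nIa] := pselect (I a); [by left|right].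
  rewrite -(Imax [set b | N (b *: (a *: y))]).
  - by move: Iab; rewrite IE /= mulrC scalerA.
  - by exists (al + del), (a *: y); split=> //; [exact: HM|move: nIa; rewrite IE].
  - by rewrite IE => c /=; case: Ns => _ _ Na /(Na a); rewrite !scalerA mulrC.
have Iideal : idealr_closed (fun b : B => `[< I b >]).
  have [I0' IB IM] := Is; split; first exact/asboolP.
    by apply/asboolPn; rewrite IE /= scale1r.
  move=> a u v /asboolP Iu /asboolP Iv; apply/asboolP.
  by apply: (submodD Is) => //; exact: IM.
have Ip : prime_idealr_closed (fun b : B => `[< I b >]).
  by move=> u v /asboolP/Iprime[?|?]; apply/orP; [left|right]; apply/asboolP.
exists del, y, (Spectrum Iideal Ip); split=> // b /=.
by rewrite IE; split=> [/asboolP|?] //; exact/asboolP.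
Qed.

End GradedPrimes.

(** * Localization and prime filtrations *)

Definition loc_frac (B : comNzRingType) (p : spectrum B) (M : lmodType B) (x : M)
  (s : denom p) : loc_mod p M := \pi_(loc_mod p M) (x, s).

Section Localization.
Variables (B : comNzRingType) (M : lmodType B) (p : spectrum B).
Implicit Types (N : set M) (K : set (loc_mod p M)).

Local Notation submod := (is_submod (fun (b : B) (x : M) => b *: x)).
Local Notation loc_submod :=
  (is_submod (fun (a : loc_ring p) (x : loc_mod p M) => a *: x)).

Lemma loc_fracD (x y : M) (s t : denom p) :
  loc_frac x s + loc_frac y t = loc_frac (dval t *: x + dval s *: y) (denomM s t).
Proof. exact: loc_addrE. Qed.

Lemma loc_fracN (x : M) (s : denom p) : - loc_frac x s = loc_frac (- x) s.
Proof. exact: loc_oppE. Qed.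

Lemma loc_fracZ (b : B^o) (x : M) (s t : denom p) :
  (loc_frac b t : loc_ring p) *: loc_frac x s = loc_frac ((b : B) *: x) (denomM t s).
Proof. exact: loc_scaleE. Qed.

Lemma loc_frac_ind (P : loc_mod p M -> Prop) :
  (forall x s, P (loc_frac x s)) -> forall z, P z.
Proof. exact: locP. Qed.

Lemma loc_frac_eq (x y : M) (s t : denom p) :
  dval t *: x = dval s *: y -> loc_frac x s = loc_frac y t.
Proof. by move=> e; apply: eq_loc. Qed.

Definition loc_set N : set (loc_mod p M) :=
  [set z | exists x s, N x /\ z = loc_frac x s].

Lemma loc_setP N x s : submod N ->
  loc_set N (loc_frac x s) <-> exists u : denom p, N (dval u *: x).
Proof.
move=> [_ _ Na]; split.
  move=> [y [t [Ny /eqP/loc_eqP[u /= e]]]]; exists (denomM u t).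
  by rewrite dvalM -scalerA e; apply: (Na); exact: Na.
move=> [u Nux]; exists (dval u *: x), (denomM u s); split=> //.
by apply: loc_frac_eq; rewrite dvalM !scalerA mulrC.
Qed.

Lemma loc_set_submod N : submod N -> loc_submod (loc_set N).
Proof.
move=> Ns; have [N0 NB Na] := Ns; split; first by exists 0, (denom1 p).
  move=> _ _ [x [s [Nx ->]]] [y [t [Ny ->]]]; rewrite loc_fracN loc_fracD.
  exists (dval t *: x - dval s *: y), (denomM s t).
  by rewrite scalerN; split=> //; apply: NB; exact: Na.
move=> a _ [x [s [Nx ->]]]; elim/locP: a => b t.
by exists ((b : B) *: x), (denomM t s); split; [exact: Na|exact: loc_fracZ].
Qed.

Lemma loc_set_mono N N' : N `<=` N' -> loc_set N `<=` loc_set N'.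
Proof. by move=> NN' _ [x [s [/NN' N'x ->]]]; exists x, s. Qed.

Lemma loc_setT : loc_set setT = setT.
Proof. by apply/seteqP; split=> //; elim/loc_frac_ind => x s _; exists x, s. Qed.

Lemma loc_set0 : loc_set [set 0] = [set 0].
Proof.
apply/seteqP; split=> [_ [x [s [-> ->]]]|_ ->]; last by exists 0, (denom1 p).
by apply: (@loc_frac_eq 0 0); rewrite !scaler0.
Qed.

(** A factor B/q with [q] not inside [p] disappears at [p]: some [s] in [q] becomes invertible. *)
Lemma loc_set_adjoin_out N (y : M) s : submod N -> ~~ p s -> N (s *: y) ->
  loc_set (adjoin N y) = loc_set N.
Proof.
move=> Ns ps Nsy; apply/seteqP; split; last by apply: loc_set_mono; exact: sub_adjoin.
move=> _ [_ [t [[z [b [Nz ->]]] ->]]]; apply/loc_setP => //.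
exists (Sub s ps : denom p); rewrite /dval SubK scalerDr scalerA mulrC -scalerA.
by case: (Ns) => _ _ Na; apply: (submodD Ns); exact: Na.
Qed.

(** The factor B/p becomes the residue field at [p]. An element of [K] outside N_p has the form (x +
    b y)/s with [b] outside [p]; dividing by [b] puts y itself in [K]. *)
Lemma loc_length_adjoin N (y : M) : submod N -> (forall b, p b <-> N (b *: y)) ->
  rel_length (fun (a : loc_ring p) (x : loc_mod p M) => a *: x)
    (loc_set N) (loc_set (adjoin N y)) 1.
Proof.
move=> Ns pN; have [N0 NB Na] := Ns.
have As := is_submod_adjoin y Ns.
have Ny s : ~ loc_set N (loc_frac y s).
  by move=> /(loc_setP _ _ Ns)[u /pN]; apply/negP; exact: (valP u).
apply: rel_length1; [exact: loc_set_submod|exact: loc_set_submod| |].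
  split; first by apply: loc_set_mono; exact: sub_adjoin.
  move=> sub; apply: (Ny (denom1 p)); apply: sub.
  by exists y, (denom1 p); split=> //; exact: mem_adjoin.
move=> K Ks NK KA; have [KN|nKN] := pselect (K `<=` loc_set N).
  by left; apply/seteqP; split.
right; apply/seteqP; split=> //.
have [z [Kz nz]] : exists z, K z /\ ~ loc_set N z.
  apply: contrapT => none; apply: nKN => z Kz; apply: contrapT => nz.
  by apply: none; exists z.
have [_ [s [[x [b [Nx ->]]] ze]]] := KA _ Kz.
have [K0 KB Ka] := Ks.
have nb : ~~ p b.
  apply/negP => /pN Nby; apply: nz; rewrite ze; exists (x + b *: y), s; split=> //.
  exact: (submodD Ns).
have Kx : K (loc_frac x s) by apply: NK; exists x, s.
have Kby : K (loc_frac (b *: y) s).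
  have -> : loc_frac (b *: y) s = z - loc_frac x s; last exact: KB.
  rewrite ze loc_fracN loc_fracD; apply: loc_frac_eq.
  by rewrite dvalM scalerN -scalerBr -scalerA addrAC subrr add0r.
have Ky t : K (loc_frac y t).
  have -> : loc_frac y t = (loc_frac (dval s : B^o) (denomM (Sub b nb) t) : loc_ring p)
      *: loc_frac (b *: y) s; last exact: Ka.
  rewrite loc_fracZ; apply: loc_frac_eq.
  by rewrite !dvalM /dval SubK !scalerA; congr (_ *: _); ring.
move=> _ [_ [t [[x' [b' [Nx' ->]]] ->]]].
have -> : loc_frac (x' + b' *: y) t =
    loc_frac x' t + (loc_frac (b' : B^o) (denom1 p) : loc_ring p) *: loc_frac y t.
  rewrite loc_fracZ loc_fracD; apply: loc_frac_eq.
  by rewrite !dvalM dval1 mul1r -scalerDr scalerA.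
apply: (submodD Ks); first by apply: NK; exists x', t.
exact: Ka.
Qed.

End Localization.

Arguments loc_set {B M} p N _.

(** * Prime filtrations of graded modules *)

Section Filtration.
Variables (r : nat) (A : comNzRingType) (B : comAlgType A) (G : 'rV[int]_r -> set B).
Hypothesis hG : is_grading G.
Hypothesis GM : forall mu nu a b, G mu a -> G nu b -> G (mu + nu) (a * b).
Hypothesis GA : forall a, G 0 (in_alg B a).
Hypothesis nB : noeth_ring B.

Definition base_act (M : lmodType B) (a : A) (x : M) : M := in_alg B a *: x.

Lemma base_actD (M : lmodType B) a (x y : M) :
  base_act a (x + y) = base_act a x + base_act a y.
Proof. exact: scalerDr. Qed.

Section Module.
Variables (M : lmodType B) (H : 'rV[int]_r -> set M).
Hypothesis hH : is_grading H.
Hypothesis HM : forall mu nu b x, G mu b -> H nu x -> H (mu + nu) (b *: x).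

Local Notation submod := (is_submod (fun (b : B) (x : M) => b *: x)).

Lemma piece_submod nu : is_submod (@base_act M) (H nu).
Proof.
split; first exact: grading0; first by move=> x y; exact: gradingB.
by move=> a x Hx; rewrite -[nu]add0r; exact: HM.
Qed.

Lemma submod_piece (N : set M) nu : submod N -> is_submod (@base_act M) (N `&` H nu).
Proof.
move=> [N0 NB Na]; apply: is_submodI; last exact: piece_submod.
by split=> // a x; exact: Na.
Qed.

(** Multiplication by [y] identifies (B/q)(-del) with (N + B y)/N, degree by degree. *)
Lemma adjoin_length (N : set M) del (y : M) (q : set B) mu k :
  submod N -> hom_set hH N -> H del y -> (forall b, q b <-> N (b *: y)) ->
  rel_length (@base_act B^o) (q `&` G mu) (G mu) k <->
  rel_length (@base_act M) (N `&` H (mu + del)) (adjoin N y `&` H (mu + del)) k.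
Proof.
move=> Ns hN Hy qN.
have -> : q `&` G mu = G mu `&` (fun b : B => b *: y) @^-1` (N `&` H (mu + del)).
  apply/seteqP; split=> b; first by move=> [/qN Nby Gb]; do ?split=> //; exact: HM.
  by move=> [Gb [/qN]].
apply: rel_length_iso.
- exact: base_actD.
- by move=> a b; rewrite scalerBl.
- by move=> a b; rewrite /base_act -scalerA.
- by split; [exact: grading0|move=> a b; exact: gradingB|
    move=> a b Gb; rewrite -[mu]add0r; exact: GM].
- exact: submod_piece.
- exact/submod_piece/is_submod_adjoin.
- by move=> x [Nx Hx]; split=> //; exact: sub_adjoin.
- move=> b Gb; split; last exact: HM.
  by exists 0, b; rewrite add0r; split=> //; case: Ns.
(* Only the component of [b] in degree [mu] matters, since [y] is homogeneous and [N] is a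
   homogeneous submodule. *)
move=> _ [[z [b [Nz ->]]] Hx]; exists (gcomp hG b mu); first exact: gcomp_in.
have e := gcomp_homog hH (mu + del) Hx.
rewrite eqxx gcompD (gcomp_scale_homog hG hH HM) // in e.
rewrite -e addrK; split; last exact: gcomp_in.
exact: hN.
Qed.

Hypothesis nM : noeth (fun (b : B) (x : M) => b *: x) setT.

(* A prime filtration of [M / N], recorded by the list of the [(q, del)] such
   that [(B / q)(- del)] is a factor. *)
Definition has_prime_filtration (N : set M) : Prop :=
  exists l : seq (spectrum B * 'rV[int]_r), [/\
    forall t, t \in l -> hom_set hG [set b | t.1 b] /\
      forall b, (forall x, N (b *: x)) -> t.1 b,
    forall hq : spectrum B -> 'rV[int]_r -> nat,
      (forall t, t \in l -> forall mu,
        rel_length (@base_act B^o) ([set b | t.1 b] `&` G mu) (G mu) (hq t.1 mu)) ->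
      forall nu, rel_length (@base_act M) (N `&` H nu) (H nu)
        (\sum_(t <- l) hq t.1 (nu - t.2)%R)%N &
    forall p : spectrum B, (forall t, t \in l -> (forall b, t.1 b -> p b) -> t.1 = p) ->
      rel_length (fun (a : loc_ring p) (x : loc_mod p M) => a *: x)
        (loc_set p N) setT (count (fun t => t.1 == p) l)].

(** Noetherian induction from the top: a prime colon ideal of M/N supplies the next factor. The
    piece lengths of the factors enter as the hypothesis on [hq], since their finiteness is itself
    derived from this theorem. The assumption on [p] leaves two kinds of factor: B/p, of length 1 at
    [p], and those that vanish there. *)
Theorem prime_filtration (N : set M) : submod N -> hom_set hH N -> has_prime_filtration N.
Proof.
move=> Ns hN; apply: contrapT => nP.
pose D := [set N | [/\ submod N, hom_set hH N & ~ has_prime_filtration N]].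
have DC : D `<=` [set K | submod K /\ K `<=` setT] by move=> K [].
have {Ns hN nP} [{}N [[Ns hN nP] Nmax]] := stabilizes_max nM DC (And3 Ns hN nP).
apply: nP; have [NT|/(exists_prime_colon hG GM nB HM Ns hN)] := pselect (N = setT).
  exists [::]; split=> // [hq _ nu|p _].
    by rewrite big_nil NT setTI; apply: rel_length0; exact: piece_submod.
  rewrite NT loc_setT /=; apply: rel_length0.
  by split.
move=> [del [y [q [Hy nNy qN]]]].
have N1s := is_submod_adjoin y Ns; have hN1 := hom_set_adjoin hG HM hN Hy.
have NN1 := sub_adjoin (N := N) y.
have [N0 NB Na] := Ns.
have [l [lann lH lloc]] : has_prime_filtration (adjoin N y).
  apply: contrapT => nP; apply: nNy; rewrite -(Nmax (adjoin N y)) //.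
  exact: mem_adjoin.
exists ((q, del) :: l); split.
- move=> t; rewrite inE => /orP[/eqP->|tl].
    split; last by move=> b /(_ y)/qN.
    have -> : [set b | (q, del).1 b] = [set b | N (b *: y)].
      by apply/seteqP; split=> b /qN.
    exact: (hom_set_colon hG HM Ns hN Hy).
  have [hq qann] := lann t tl; split=> // b Nb; apply: qann => x; exact/NN1/Nb.
- move=> hq hql nu; rewrite big_cons /=.
  have qs : rel_length (@base_act M) (N `&` H nu) (adjoin N y `&` H nu) (hq q (nu - del)).
    rewrite -{1 2}(subrK del nu).
    apply/(adjoin_length (nu - del) (hq q (nu - del)) Ns hN Hy qN).
    exact: (hql (q, del)) (mem_head _ _) _.
  apply: (rel_lengthD (@base_actD M)) qs (lH hq _ nu).
  + exact: submod_piece.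
  + exact: submod_piece.
  + exact: piece_submod.
  + exact: setSI.
  + by move=> x [].
  + by move=> t tl; apply: hql; rewrite inE tl orbT.
- move=> p pl /=.
  have {lloc} := lloc p (fun t tl => pl t (mem_behead (s := (q, del) :: l) tl)).
  have [qp|qp] := eqVneq q p.
    rewrite -qp => lloc.
    apply: (rel_lengthD _ _ _ _ _ _ _ lloc).
    + by move=> a x z; exact: scalerDr.
    + exact: loc_set_submod.
    + exact: loc_set_submod.
    + by split.
    + exact: loc_set_mono.
    + by [].
    + exact: loc_length_adjoin.
  have [s qs ps] : exists2 s, q s & ~~ p s.
    apply: contrapT => none; case/eqP: qp; apply: (pl (q, del)) (mem_head _ _) _ => b qb.
    by apply: contrapT => /negP pb; apply: none; exists b.
  by rewrite (loc_set_adjoin_out Ns ps) //; exact/qN.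
Qed.

End Module.
End Filtration.

(** * Hilbert functions of the quotients by homogeneous primes *)

Section SpecOver.
Variable B : comNzRingType.
Implicit Types (I : set B) (p q : spectrum B).

Definition spec_over I : set (set B) :=
  [set P | exists p : spectrum B, P = [set a | p a] /\ forall a, I a -> p a].

Definition dim_le I (d : nat) : Prop :=
  forall j X, chain_to (spec_over I) j X -> (j <= d)%N.

(** Chains above [q] are prolonged by [p] at the bottom; the chain consisting of [q] alone excludes
    d = 0. *)
Lemma dim_le_proper p q d : (forall a, p a -> q a) -> p <> q ->
  dim_le [set a | p a] d -> exists2 d', d = d'.+1 & dim_le [set a | q a] d'.
Proof.
move=> pq ne pd.
have lt X : spec_over [set a | q a] X -> [set a | p a] `<` X.
  move=> [q' [-> qq']]; split=> [a /pq /qq' //|qp']; apply: ne; apply: spectrum_ext => a.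
  by apply/idP/idP => [/pq //|/qq' /qp'].
have over j X : chain_to (spec_over [set a | q a]) j X ->
    chain_to (spec_over [set a | p a]) j.+1 X.
  have sub X' : spec_over [set a | q a] X' -> spec_over [set a | p a] X'.
    by move=> [q' [-> qq']]; exists q'; split=> // a /pq /qq'.
  move: j X; apply: chain_to_ind => [X qX|j X Y IH _ qY XY].
    by apply: (chain_toS _ (sub X qX) (lt X qX)); apply: chain_to0; exists p.
  exact: chain_toS IH (sub _ qY) XY.
case: d pd => [|d] pd; last by exists d => // j X /over /pd.
have : spec_over [set a | q a] [set a | q a] by exists q.
by move=> /chain_to0 /over /pd.
Qed.

End SpecOver.

Section PrimeHilbert.
Variables (r : nat) (A : comNzRingType) (B : comAlgType A) (G : 'rV[int]_r -> set B).
Hypothesis r_gt0 : (0 < r)%N.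
Hypothesis hA : artinian A.
Hypothesis hB : standard_graded G.
Hypothesis hG : is_grading G.

Implicit Types mu nu : 'rV[int]_r.

Let GM : forall mu nu a b, G mu a -> G nu b -> G (mu + nu) (a * b).
Proof. by case: hB => -[]. Qed.

Let GMo : forall mu nu (b : B) (x : B^o), G mu b -> G nu x -> G (mu + nu) (b *: x).
Proof. exact: GM. Qed.

Lemma standard_in_alg a : G 0 (in_alg B a).
Proof. by case: hB => _ _ [_ ->] _; exists a. Qed.

Lemma standard_eq0 (nu : 'rV[int]_r) (i : 'I_r) : nu 0 i < 0 -> G nu = [set 0].
Proof.
move=> lt; case: hB => _ + _ _; apply=> /(_ i); rewrite leNgt lt //.
Qed.

Let nB : noeth_ring B.
Proof. exact: standard_graded_noeth hA hB. Qed.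

(** The value 0 is a default for pieces of infinite length; [prime_hilbP] gives the meaning as soon
    as some length exists. *)
Definition prime_hilb (q : spectrum B) mu : nat :=
  xget 0%N [set k | rel_length (@base_act A B B^o) ([set b | q b] `&` G mu) (G mu) k].

Lemma prime_hilbP (q : spectrum B) mu k :
  rel_length (@base_act A B B^o) ([set b | q b] `&` G mu) (G mu) k ->
  prime_hilb q mu = k /\
  rel_length (@base_act A B B^o) ([set b | q b] `&` G mu) (G mu) (prime_hilb q mu).
Proof.
move=> hk; have hx : rel_length (@base_act A B B^o) ([set b | q b] `&` G mu) (G mu)
    (prime_hilb q mu) by apply: (xgetPex 0%N); exists k.
by split=> //; exact: max_chain_uniq hx hk.
Qed.

Lemma spectrum_submod (q : spectrum B) :
  is_submod (fun (b : B) (x : B^o) => b *: x) [set b | q b].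
Proof.
have [q0 _ qM] := spec_idealr q; split=> // [x y qx qy|a x qx] /=.
  by have := qM (-1) y x qy qx; rewrite mulN1r addrC.
by have := qM a x 0 qx q0; rewrite addr0.
Qed.

Lemma spectrumN1 (q : spectrum B) : ~ q 1.
Proof. by case: (spec_idealr q) => _ /negP. Qed.

Lemma spectrumM (q : spectrum B) a b : q (a * b) -> q a \/ q b.
Proof. by move/(@spec_prime B q)/orP. Qed.

Let pieceB mu : is_submod (@base_act A B B^o) (G mu).
Proof. exact: (piece_submod standard_in_alg (M := B^o) hG GMo). Qed.

(* Here [B = A + q], so that [B / q] is the field [A / (A :&: q)], in degree 0. *)
Lemma prime_hilb_irrelevant (q : spectrum B) : hom_set hG [set b | q b] ->
  (forall i x, G (unit_vec i) x -> q x) ->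
  forall mu, rel_length (@base_act A B B^o) ([set b | q b] `&` G mu) (G mu) (mu == 0).
Proof.
move=> hq qgen mu; have qs := spectrum_submod q; have [q0 qB qZ] := qs.
have qD a b : q a -> q b -> q (a + b) by move=> qa qb; exact: (submodD qs qa qb).
(* The elements congruent to a scalar modulo [q] form a subalgebra containing the generators. *)
have BAq b : exists a, q (b - in_alg B a).
  case: hB => _ _ _ [s [sgen gen]].
  suff /asboolP : b \in [pred b | `[< exists a, q (b - in_alg B a) >]] by [].
  apply: gen => [|x /sgen[i /qgen qx]]; last first.
    by apply/asboolP; exists 0; rewrite /= scale0r subr0.
  split; first by apply/asboolP; exists 1; rewrite /= scale1r subrr.
    move=> c u v /asboolP[a qa] /asboolP[a' qa']; apply/asboolP; exists (c * a + a').
    rewrite rmorphD rmorphM opprD addrACA; apply: qD => //.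
    have -> : c *: u - in_alg B c * in_alg B a = in_alg B c * (u - in_alg B a).
      by rewrite mulrBr; congr (_ - _); rewrite /= mulr_algl.
    exact: qZ.
  move=> u v /asboolP[a qa] /asboolP[a' qa']; apply/asboolP; exists (a * a').
  rewrite rmorphM.
  have -> : u * v - in_alg B a * in_alg B a' =
    v * (u - in_alg B a) + in_alg B a * (v - in_alg B a') by ring.
  by apply: qD; exact: qZ.
have qsG : is_submod (@base_act A B B^o) ([set b | q b] `&` G mu).
  exact: (submod_piece standard_in_alg (M := B^o) hG GMo).
have [mu0|mu0] /= := eqVneq mu 0; last first.
  rewrite (_ : _ `&` _ = G mu); first exact: rel_length0.
  apply/seteqP; split=> [b []//|b Gb]; split=> //.
  have [a qa] := BAq b; have := hq _ mu qa.
  rewrite gcompD (gcomp_homog hG mu Gb) eqxx.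
  have Ga : G 0 (- in_alg B a).
    rewrite -sub0r; apply: (gradingB hG); first exact: grading0.
    exact: standard_in_alg.
  by rewrite (gcomp_homog hG mu Ga) (negbTE mu0) addr0.
subst mu; apply: rel_length1 => //.
  split=> [b []//|sub]; have : G 0 1.
    by have := standard_in_alg 1; rewrite rmorph1.
  by move=> /sub[/spectrumN1].
move=> K Ks qK KG; have [Kq|nKq] := pselect (K `<=` [set b | q b]).
  by left; apply/seteqP; split=> // b Kb; split; [exact: Kq|exact: KG].
right; apply/seteqP; split=> //.
have [z Kz nz] : exists2 z, K z & ~ q z.
  apply: contrapT => none; apply: nKq => z Kz; apply: contrapT => nz.
  by apply: none; exists z.
have GE : G 0 = range (in_alg B) by case: hB => _ _ [].
have [a _ az] : range (in_alg B) z by rewrite -GE; exact: KG.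
(* As a^k (1 - a c) = 0 lies in [q] and [a] does not, [c] inverts [a] modulo [q]; hence [K] contains
   1. *)
have [k [c akc]] := artinian_expr hA a.
have q1 : q (1 - in_alg B a * in_alg B c).
  have : q (in_alg B a ^+ k * (1 - in_alg B a * in_alg B c)).
    rewrite mulrBr mulr1 mulrA -exprSr -!rmorphXn -rmorphM -akc subrr.
    exact: q0.
  case/spectrumM => // qak; case: nz; rewrite -az.
  elim: (k) qak => [/spectrumN1 //|j IHj]; rewrite exprS.
  by case/spectrumM.
have [K0 KB Ka] := Ks.
have K1 : K 1.
  rewrite -(subrK (in_alg B a * in_alg B c) 1); apply: (submodD Ks).
    apply: qK; split=> //; apply: (gradingB hG).
      by have := standard_in_alg 1; rewrite rmorph1.
    by rewrite -rmorphM; exact: standard_in_alg.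
  by rewrite mulrC az; exact: (Ka c z Kz).
move=> b; rewrite GE => -[a' _ <-].
by have := Ka a' 1 K1; rewrite /base_act /GRing.scale /= mulr1.
Qed.

Lemma ndeg0 : ndeg 0 (0 : 'rV[int]_r).
Proof. by apply/ndegP; split=> [i|]; rewrite ?/vsum ?big1 ?mxE // => i _; rewrite mxE. Qed.

Lemma pole_dec_delta : pole_dec 0 (fun mu : 'rV[int]_r => (mu == 0)%:Z) (fun n => (n == 0)%:Z).
Proof.
exists [:: (1, (0, 0))]; split=> [t|mu|n _].
- by rewrite inE => /eqP->; exact: ndeg0.
- rewrite /pole_sum big_seq1 mul1r /=.
  have [->|mu0] := eqVneq mu 0; first by rewrite /pole_term big1 // => i _; rewrite !mxE.
  have [i mui] : exists i, mu 0 i != 0.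
    apply: contrapT => /forallNP none; case/eqP: mu0; apply/rowP => i; rewrite mxE.
    by apply/eqP; have := none i => /negP; rewrite negbK.
  rewrite /pole_term (bigD1 i) //= !mxE subr0.
  rewrite (_ : inv_coef 0 (mu 0 i) = 0) ?mul0r //.
  case: (mu 0 i) mui => [k|k] k0; last by rewrite inv_coef_neg.
  by rewrite inv_coef0; case: k k0.
- by rewrite /pole_val big_cons big_nil /= addr0 eq_sym; case: eqP.
Qed.

(** Any bound [d] of the dimension of B/q is allowed, because all factors of a module are decomposed
    at the common order chosen for that module. *)
Definition prime_dec (q : spectrum B) : Prop :=
  (forall mu, rel_length (@base_act A B B^o) ([set b | q b] `&` G mu) (G mu)
     (prime_hilb q mu)) /\
  forall d, dim_le [set b | q b] d ->
    exists2 e, (forall n, 0 <= e n) & pole_dec d (fun mu => (prime_hilb q mu)%:Z) e.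

Let i0 : 'I_r := Ordinal r_gt0.

Lemma prime_dec_irrelevant (q : spectrum B) : hom_set hG [set b | q b] ->
  (forall i x, G (unit_vec i) x -> q x) -> prime_dec q.
Proof.
move=> hq qgen; have hl mu := prime_hilbP (prime_hilb_irrelevant hq qgen mu).
split=> [mu|d _]; first by case: (hl mu).
have -> : (fun mu => (prime_hilb q mu)%:Z) = (fun mu : 'rV[int]_r => (mu == 0)%:Z).
  by apply/funext => mu; have [-> _] := hl mu.
case: d => [|d]; first by exists (fun n => (n == 0)%:Z) => //; exact: pole_dec_delta.
by exists (fun=> 0) => //; apply: (pole_dec_lt i0 pole_dec_delta).
Qed.

(* The exact sequence [0 -> (B/q)(- e_i) -> B/q -> B/(q + x) -> 0] and a prime
   filtration of [B/(q + x)], all of whose primes strictly contain [q]. *)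
Lemma prime_dec_step (q : spectrum B) i x : hom_set hG [set b | q b] ->
  G (unit_vec i) x -> ~ q x ->
  (forall q' : spectrum B, hom_set hG [set b | q' b] -> (forall a, q a -> q' a) ->
     q <> q' -> prime_dec q') ->
  prime_dec q.
Proof.
move=> hq Gx nqx IH; have qs := spectrum_submod q.
(* B/q is a domain and [x] is nonzero in it: the colon ideal (q : x) is [q] itself, which identifies
   (q + B x)/q with a shift of B/q. *)
have qcolon b : [set b | q b] b <-> [set b | q b] (b *: (x : B^o)).
  split=> /= [qb|/spectrumM[]//]; rewrite /GRing.scale /= mulrC.
  by case: qs => _ _; apply.
pose N : set B^o := adjoin ([set b | q b] : set B^o) (x : B^o).
have Ns : is_submod (fun (b : B) (y : B^o) => b *: y) N by exact: is_submod_adjoin.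
have hN : hom_set hG N by exact: (hom_set_adjoin hG (M := B^o) GMo hq Gx).
have qN : [set b | q b] `<=` N by exact: (@sub_adjoin B B^o).
have nBo : noeth (fun (b : B) (y : B^o) => b *: y) setT by exact: nB.
have [l [lann lH _]] := prime_filtration hG GM standard_in_alg nB GMo nBo Ns hN.
(* [x] annihilates B/(q + x), so every prime of the filtration contains it, while [q] does not. *)
have lq t : t \in l -> (forall a, q a -> t.1 a) /\ q <> t.1.
  move=> /lann[_ ann]; split=> [a qa|e].
    apply: ann => y; apply: qN => /=; rewrite /GRing.scale /= mulrC.
    by case: qs => _ _; apply.
  apply: nqx; rewrite e; apply: ann => y.
  have -> : x *: y = (y : B) *: (x : B^o) :> B^o by exact: mulrC.
  case: Ns => _ _; apply; apply: mem_adjoin.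
  by case: qs.
have lgood t : t \in l -> prime_dec t.1.
  by move=> tl; have [le ne] := lq t tl; apply: IH => //; case: (lann t tl).
pose g nu := (\sum_(t <- l) prime_hilb t.1 (nu - t.2)%R)%N.
have gP nu : rel_length (@base_act A B B^o) (N `&` G nu) (G nu) (g nu).
  by apply: lH => t tl mu; case: (lgood t tl).
have step nu k : rel_length (@base_act A B B^o)
      ([set b | q b] `&` G (nu - unit_vec i)) (G (nu - unit_vec i)) k ->
    rel_length (@base_act A B B^o) ([set b | q b] `&` G nu) (G nu) (k + g nu).
  move=> hk; apply: (rel_lengthD (@base_actD A B B^o)) _ (gP nu).
  - exact: (submod_piece standard_in_alg (M := B^o) hG GMo).
  - exact: (submod_piece standard_in_alg (M := B^o) hG GMo).
  - exact: pieceB.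
  - exact: setSI.
  - by move=> y [].
  have := adjoin_length hG GM standard_in_alg (M := B^o) GMo (nu - unit_vec i) k qs hq Gx qcolon.
  by rewrite subrK => -[+ _]; apply.
have low nu : nu 0 i < 0 -> rel_length (@base_act A B B^o) ([set b | q b] `&` G nu) (G nu) 0.
  move=> /standard_eq0 G0; rewrite (_ : _ `&` _ = G nu); first exact: rel_length0.
  rewrite G0; apply/seteqP; split=> [b []//|_ ->]; split=> //.
  by case: qs.
(* The length recursion is run upwards in nu_i from the negative degrees, where the pieces are 0. *)
have ex nu : exists k, rel_length (@base_act A B B^o) ([set b | q b] `&` G nu) (G nu) k.
  have [m] := ubnP (absz (nu 0%R i)); elim: m nu => // m IHm nu num.
  case: (ltP (nu 0 i) 0) => [/low|nu0]; first by exists 0%N.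
  case: (ltP (nu 0 i - 1) 0) => [lt|ge].
    exists (0 + g nu)%N; apply: step; apply: low.
    by rewrite !mxE !eqxx /=.
  have [|k hk] := IHm (nu - unit_vec i); last by exists (k + g nu)%N; exact: step.
  by rewrite !mxE !eqxx /=; lia.
have hl nu : rel_length (@base_act A B B^o) ([set b | q b] `&` G nu) (G nu) (prime_hilb q nu).
  by have [k /prime_hilbP[]] := ex nu.
have hS nu : prime_hilb q nu = (prime_hilb q (nu - unit_vec i) + g nu)%N.
  by have [-> _] := prime_hilbP (step nu _ (hl _)).
have h0 nu : nu 0 i < 0 -> prime_hilb q nu = 0%N.
  by move=> /low/prime_hilbP[].
(* A prime of [l] is what shows d > 0. If there is none, the Hilbert function is shift-invariant,
   hence 0, and the empty decomposition serves for every [d]. *)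
split=> // d qd; have [l0|[t0 t0l]] : l = [::] \/ exists t, t \in l.
    by case: (l) => [|t l']; [left|right; exists t; exact: mem_head].
  exists (fun=> 0) => //; rewrite (_ : (fun mu => _) = fun=> 0); first exact: pole_dec0.
  apply/funext => mu; apply: (bounded_below_eq0 (i := i) (h := fun mu => (prime_hilb q mu)%:Z) (K := 0)).
    by move=> nu; rewrite hS /g l0 big_nil addn0.
  by move=> nu /h0 ->.
have [d' dE _] := dim_le_proper (proj1 (lq t0 t0l)) (proj2 (lq t0 t0l)) qd.
have ed t : exists e, t \in l -> (forall n, 0 <= e n) /\
    pole_dec d' (fun nu => (prime_hilb t.1 (nu - t.2))%:Z) e.
  have [tl|] := boolP (t \in l); last by exists (fun=> 0).
  have [d'' d'E tdim] := dim_le_proper (proj1 (lq t tl)) (proj2 (lq t tl)) qd.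
  have [_ /(_ d'')[]] := lgood t tl => // e e0 tdec; exists e => _; split=> //.
  have -> : d' = d'' by move: d'E; rewrite dE => -[].
  exact: (pole_dec_shift t.2 tdec).
have /choice[e He] := ed.
have gdec := pole_dec_big (fun t tl => proj2 (He t tl)).
rewrite dE; eexists; last first.
  apply: (pole_dec_sum (i := i)) gdec _ _ => nu /=.
    rewrite hS /g PoszD addrAC subrr add0r.
    by elim/big_rec2: _ => // t y1 y2 _; rewrite PoszD => ->.
  by move=> /h0 ->.
move=> n /=; case: ifP => // _; rewrite big_seq; apply: sumr_ge0 => t tl.
by case: (He t tl).
Qed.

Theorem prime_decP (q : spectrum B) : hom_set hG [set b | q b] -> prime_dec q.
Proof.
move=> hq; apply: contrapT => nE.
pose D := [set I : set B | exists q : spectrum B,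
  [/\ I = [set b | q b], hom_set hG I & ~ prime_dec q]].
have DC : D `<=` [set K | is_ideal K /\ K `<=` setT].
  by move=> _ [q' [-> _ _]]; split=> //; exact: spectrum_submod.
have Dq : D [set b | q b] by exists q.
have [I [[{hq nE Dq}q [-> hq nE]] Imax]] := stabilizes_max nB DC Dq.
apply: nE; have [qgen|] := pselect (forall i x, G (unit_vec i) x -> q x).
  exact: prime_dec_irrelevant.
move=> /existsNP[i /existsNP[x /not_implyP[Gx nqx]]].
apply: (prime_dec_step hq Gx nqx) => q' hq' qq' ne; apply: contrapT => nE.
apply: ne; apply: spectrum_ext => a.
have e : [set b | q' b] = [set b | q b] by apply: Imax => //; exists q'.
have : [set b | q' b] a <-> [set b | q b] a by rewrite e.
by move=> [h1 h2]; apply/idP/idP.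
Qed.

End PrimeHilbert.

(** * Mixed multiplicities *)

Section MixedMultiplicityTheory.
Variable r : nat.
Implicit Types n mu nu : 'rV[int]_r.

(** A finite enumeration of the index set of the sum in [hilb_decomp]; coordinates of such vectors
    are at most [d]. *)
Definition ndeg_seq (d : nat) : seq 'rV[int]_r :=
  undup [seq n <- [seq \row_i ((f i : nat)%:Z) | f : {ffun 'I_r -> 'I_d.+1}] | ndeg d n].

Lemma mem_ndeg_seq d n : (n \in ndeg_seq d) = ndeg d n.
Proof.
rewrite mem_undup mem_filter; case: (boolP (ndeg d n)) => //= /ndegP[n0 nd].
have lt i : (absz (n 0%R i) < d.+1)%N.
  have : n 0 i <= d%:Z.
    rewrite -nd /vsum (bigD1 i) //= lerDl; apply: sumr_ge0 => j _; exact: n0.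
  by have := n0 i; lia.
pose F (f : {ffun 'I_r -> 'I_d.+1}) : 'rV[int]_r := \row_i ((f i : nat)%:Z).
have nE : F [ffun i => Ordinal (lt i)] = n.
  by apply/rowP => i; rewrite mxE ffunE /= gez0_abs.
by rewrite -[X in X \in _]nE; exact: (codom_f F).
Qed.

Lemma degsE d : degs (d%:Z)%:E%E = [set` ndeg_seq d] :> set 'rV[int]_r.
Proof.
apply/seteqP; split=> n /=; rewrite mem_ndeg_seq.
  by move=> [n0 [nd]]; apply/ndegP.
by move/ndegP => [n0 nd]; split; rewrite ?nd.
Qed.

Variables (A : comNzRingType) (B : comAlgType A).

Section OneModule.
Variables (M : lmodType B) (H : 'rV[int]_r -> set M) (d : nat).
Hypothesis Md : krull_dim M = (d%:Z)%:E%E.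

Lemma pole_dec_of_hilb_decomp Q : hilb_decomp H Q ->
  pole_dec d (hilb H) (fun n => eval1 (Q n)).
Proof.
rewrite /hilb_decomp Md degsE => -[_ hE].
exists [seq (Q n mu, (n, mu)) | n <- ndeg_seq d, mu <- finsupp (Q n)]; split.
- by move=> t /allpairsPdep[n [mu [+ _ ->]]]; rewrite mem_ndeg_seq.
- move=> nu; rewrite hE -fsbig_seq ?undup_uniq // /pole_sum big_allpairs_dep.
  by apply: eq_bigr.
- move=> n nd; rewrite /pole_val big_mkcond big_allpairs_dep /=.
  rewrite (bigD1_seq n) ?undup_uniq ?mem_ndeg_seq //= [X in _ + X]big1 ?addr0.
    by apply: eq_bigr => mu _; rewrite eqxx.
  by move=> m /negbTE mn; rewrite big1 // => mu _; rewrite mn.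
Qed.

(** The entries of the list are regrouped by exponent into Laurent polynomials supported in the
    common set [U]. *)
Lemma hilb_decomp_of_pole_dec e : (forall n, 0 <= e n) -> pole_dec d (hilb H) e ->
  exists2 Q, hilb_decomp H Q & forall n, ndeg d n -> eval1 (Q n) = e n.
Proof.
move=> e0 [s [sd hs es]].
pose U := undup [seq t.2.2 | t <- s].
pose Q n : laurent r := [fsfun mu in [fset mu in U]%fset =>
  \sum_(t <- s | t.2 == (n, mu)) t.1 | 0].
have QE n mu : Q n mu = \sum_(t <- s | t.2 == (n, mu)) t.1.
  rewrite fsfunE inE /= mem_undup; case: ifPn => // nU.
  rewrite big_seq_cond big1 // => t /andP[ts /eqP tE]; case/negP: nU.
  by apply/mapP; exists t; rewrite ?tE.
have QU n mu : mu \in finsupp (Q n) -> mu \in U.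
  rewrite mem_finsupp QE => ne; apply: contraNT ne; rewrite mem_undup => nU.
  rewrite big_seq_cond big1 // => t /andP[ts /eqP tE]; case/negP: nU.
  by apply/mapP; exists t; rewrite ?tE.
have sumQ n (F : 'rV[int]_r -> int) :
    \sum_(mu <- finsupp (Q n)) Q n mu * F mu = \sum_(t <- s | t.2.1 == n) t.1 * F t.2.2.
  rewrite (@sum_supp_widen _ _ (fun mu => Q n mu * F mu) _ U) ?undup_uniq //; last first.
  - by move=> mu; rewrite memNfinsupp => /eqP ->; rewrite mul0r.
  - exact: QU.
  - exact: fset_uniq.
  under eq_bigr => mu _ do rewrite QE mulr_suml.
  rewrite (exchange_big_dep (fun t => t.2.1 == n)) /=; last first.
    by move=> mu t _ /eqP ->.
  rewrite big_seq_cond [RHS]big_seq_cond; apply: eq_bigr => t /andP[ts /eqP tn].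
  rewrite big_mkcond (bigD1_seq t.2.2) ?undup_uniq //=; last first.
    by rewrite mem_undup; apply/mapP; exists t.
  rewrite -tn -surjective_pairing eqxx big1 ?addr0 // => mu mut.
  case: eqP => // tE; case/negP: mut; by rewrite tE.
have evQ n : eval1 (Q n) = pole_val s n.
  rewrite /eval1 /pole_val; have := sumQ n (fun=> 1).
  under eq_bigr do rewrite mulr1.
  by under [in RHS]eq_bigr do rewrite mulr1.
exists Q => [|n nd]; last by rewrite evQ es.
rewrite /hilb_decomp Md degsE; split=> [n /=|nu].
  by rewrite mem_ndeg_seq => nd; rewrite evQ -es.
rewrite -fsbig_seq ?undup_uniq // hs /pole_sum.
under [RHS]eq_bigr => n _ do
  rewrite (sumQ n (fun mu => \prod_i inv_coef (n 0 i) (nu 0 i - mu 0 i))).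
rewrite (exchange_big_dep xpredT) //= big_seq [RHS]big_seq; apply: eq_bigr => t ts.
rewrite big_mkcond (bigD1_seq t.2.1) ?undup_uniq ?mem_ndeg_seq ?sd //= eqxx.
rewrite [X in _ + X]big1 ?addr0 // => n; by rewrite eq_sym => /negbTE ->.
Qed.

End OneModule.

(** The two halves serve the two branches of [mixed_mult]: the first makes the set of candidate
    values nonempty, the second matches the value 0 above the dimension. *)
Definition hilb_admissible (M : lmodType B) (H : 'rV[int]_r -> set M) (d : nat) : Prop :=
  (exists2 e, (forall n, 0 <= e n) & pole_dec d (hilb H) e) /\
  ((krull_dim M < (d%:Z)%:E)%E -> pole_dec d (hilb H) (fun=> 0)).

(** Whichever decomposition [xget] selects, uniqueness identifies its value with that of [e], which
    may come from any decomposition of order [d]. *)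
Lemma mixed_mult_pole (M : lmodType B) (H : 'rV[int]_r -> set M) n (d : nat) e :
  ndeg d (n + const_mx 1) -> (krull_dim M <= (d%:Z)%:E)%E ->
  hilb_admissible H d -> pole_dec d (hilb H) e ->
  mixed_mult H n = e (n + const_mx 1).
Proof.
move=> nd Md [[e' e'0 he'] h0] he; rewrite /mixed_mult.
have [_ vd] := ndegP _ _ nd; rewrite vd.
case: asboolP => [dM|ne]; last first.
  rewrite (pole_dec_uniq he (h0 _) nd) // lt_neqAle Md andbT.
  by apply/eqP => e1; apply: ne.
have [Q hQ Qe'] := hilb_decomp_of_pole_dec (esym dM) e'0 he'.
set S := [set v | _]; have : S (xget 0 S).
  by apply: (xgetPex 0); exists (eval1 (Q (n + const_mx 1))), Q.
move=> [Q' [hQ' ->]].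
exact: pole_dec_uniq (pole_dec_of_hilb_decomp (esym dM) hQ') he _ nd.
Qed.

End MixedMultiplicityTheory.

Lemma spec_over_mono (B : comNzRingType) (I J : set B) : (forall a, I a -> J a) ->
  spec_over J `<=` spec_over I.
Proof. by move=> IJ P [p [-> Jp]]; exists p; split=> // a /IJ /Jp. Qed.

Lemma chain_sup_mono (T : Type) (C C' : set (set T)) : C `<=` C' ->
  (chain_sup C <= chain_sup C')%E.
Proof.
move=> CC'; apply: chain_sup_le => k X Ck; apply: chain_sup_ge.
exact: chain_to_sub Ck.
Qed.

Lemma krull_dimE (B : comNzRingType) (M : lmodType B) :
  krull_dim M = chain_sup (spec_over [set a | forall x : M, a *: x = 0]).
Proof. by []. Qed.

Lemma quot_pi_eq0 (B : comNzRingType) (q : spectrum B) (b : B) :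
  (\pi_{ideal_quot (prime_of q)} b : quot_mod q) = 0 <-> q b.
Proof.
have -> : q b = (b - 0 \in prime_of q) by rewrite subr0.
rewrite Quotient.idealrBE; split=> [e|/eqP e]; last by rewrite e; exact: rmorph0.
by apply/eqP; apply: etrans e _; symmetry; exact: rmorph0.
Qed.

Lemma krull_dim_quot (B : comNzRingType) (q : spectrum B) :
  krull_dim (quot_mod q) = chain_sup (spec_over [set a | q a]).
Proof.
rewrite krull_dimE; congr (chain_sup (spec_over _)); apply/seteqP; split=> a /=.
  move=> /(_ 1) a1; apply/quot_pi_eq0; rewrite -a1.
  by rewrite /GRing.scale /= /quot_scale mulr1.
move=> /quot_pi_eq0 a0 x.
by rewrite /GRing.scale /= /quot_scale a0 mul0r.
Qed.

Lemma dim_le_chain_sup (B : comNzRingType) (I : set B) (d : nat) :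
  (chain_sup (spec_over I) <= (d%:Z)%:E)%E -> dim_le I d.
Proof.
move=> Id j X /chain_sup_ge/le_trans/(_ Id).
by rewrite lee_fin lez_nat.
Qed.

(** * Shift invariance, associativity and additivity *)

Section Main.
Variables (r : nat) (A : comNzRingType) (B : comAlgType A) (G : 'rV[int]_r -> set B).
Hypothesis r_gt0 : (0 < r)%N.
Hypothesis hA : artinian A.
Hypothesis hB : standard_graded G.
Implicit Types n mu nu : 'rV[int]_r.

Let hG : is_grading G.
Proof. by case: hB => -[]. Qed.

Let GM : forall mu nu a b, G mu a -> G nu b -> G (mu + nu) (a * b).
Proof. by case: hB => -[]. Qed.

Let nB : noeth_ring B.
Proof. exact: standard_graded_noeth hA hB. Qed.

(** The numerical trace of a prime filtration; for B/q the one-entry list provides it directly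
    ([filtered_quot]). *)
Definition filtered (M : lmodType B) (H : 'rV[int]_r -> set M)
    (l : seq (spectrum B * 'rV[int]_r)) : Prop :=
  (forall t, t \in l -> hom_set hG [set b | t.1 b] /\
     forall b, (forall x : M, b *: x = 0) -> t.1 b) /\
  forall nu, hilb H nu = \sum_(t <- l) (prime_hilb G t.1 (nu - t.2))%:Z.

Lemma filtered_dec (M : lmodType B) (H : 'rV[int]_r -> set M) l (d : nat) :
  filtered H l -> (krull_dim M <= (d%:Z)%:E)%E ->
  exists2 e, (forall n, 0 <= e n) & pole_dec d (hilb H) e.
Proof.
move=> [lann hE] Md.
have tdim t : t \in l -> dim_le [set b | t.1 b] d.
  move=> /lann[_ ann]; apply: dim_le_chain_sup; apply: le_trans Md.
  by apply: chain_sup_mono; exact: spec_over_mono.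
have ed t : exists e, t \in l -> (forall n, 0 <= e n) /\
    pole_dec d (fun nu => (prime_hilb G t.1 (nu - t.2))%:Z) e.
  have [tl|] := boolP (t \in l); last by exists (fun=> 0).
  have [hq _] := lann t tl; have [_ /(_ _ (tdim t tl))[e e0 he]] := prime_decP r_gt0 hA hB hq.
  by exists e => _; split=> //; exact: (pole_dec_shift t.2 he).
have /choice[e He] := ed.
exists (fun n => \sum_(t <- l) e t n).
  by move=> n; rewrite big_seq; apply: sumr_ge0 => t tl; case: (He t tl).
have -> : hilb H = fun nu => \sum_(t <- l) (prime_hilb G t.1 (nu - t.2))%:Z.
  by apply/funext.
exact: pole_dec_big (fun t tl => proj2 (He t tl)).
Qed.

Lemma filtered_admissible (M : lmodType B) (H : 'rV[int]_r -> set M) l (d : nat) :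
  filtered H l -> (krull_dim M <= (d%:Z)%:E)%E -> hilb_admissible H d.
Proof.
move=> fl Md; split; first exact: filtered_dec fl Md.
(* For d = 0 the dimension is negative and no prime contains the annihilator, so [l] is empty.
   Otherwise the dimension is at most the predecessor, and a decomposition of that order is
   raised. *)
case: d {Md} => [|d] Md.
  have [_ hE] := fl; have -> : hilb H = fun=> 0; last exact: pole_dec0.
  apply/funext => nu; rewrite hE; have -> : l = [::]; last by rewrite big_nil.
  case: l fl {hE} => // t l [/(_ t (mem_head _ _))[_ ann] _]; exfalso.
  have : spec_over [set a | forall x : M, a *: x = 0] [set a | t.1 a] by exists t.1.
  by move=> /chain_to0/chain_sup_ge; rewrite leNgt -krull_dimE Md.
have Md' : (krull_dim M <= (d%:Z)%:E)%E.
  rewrite krull_dimE; apply: chain_sup_le => k X /chain_sup_ge kM.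
  have := le_lt_trans kM Md; rewrite lte_fin lee_fin ltz_nat lez_nat; lia.
have [e _ he] := filtered_dec fl Md'.
exact: (pole_dec_lt (Ordinal r_gt0) he).
Qed.

Lemma hilbE (M : lmodType B) (H : 'rV[int]_r -> set M) nu k :
  rel_length (@base_act A B M) [set 0] (H nu) k -> hilb H nu = k.
Proof. by move=> hk; rewrite /hilb (mod_lengthE hk). Qed.

Lemma prime_hilb_length (q : spectrum B) mu : hom_set hG [set b | q b] ->
  rel_length (@base_act A B B^o) ([set b | q b] `&` G mu) (G mu) (prime_hilb G q mu).
Proof. by move=> /(prime_decP r_gt0 hA hB)[]. Qed.

Lemma hilb_quot (q : spectrum B) mu : hom_set hG [set b | q b] ->
  hilb (quot_grading q G) mu = prime_hilb G q mu.
Proof.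
move=> hq; apply: hilbE.
pose phi (b : B^o) : quot_mod q := \pi_{ideal_quot (prime_of q)} (b : B).
have phiB : {morph phi : x y / x - y} by move=> x y; exact: rmorphB.
have phi_act (a : A) (b : B^o) : phi (base_act a b) = base_act a (phi b).
  by rewrite /phi /base_act; exact: rmorphM.
have Gs : is_submod (@base_act A B B^o) (G mu).
  apply: (piece_submod (standard_in_alg hB) (M := B^o) hG) => mu' nu a b; exact: GM.
have [G0 GB Ga] := Gs.
have iso k : rel_length (@base_act A B B^o) (G mu `&` phi @^-1` [set 0]) (G mu) k <->
    rel_length (@base_act A B (quot_mod q)) [set 0] (quot_grading q G mu) k.
  apply: rel_length_iso => //.
  - exact: base_actD.
  - split=> // [_ _ -> ->|a _ ->]; [exact: subr0|exact: scaler0].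
  - split; first by exists 0 => //; exact: rmorph0.
      move=> _ _ [x Gx <-] [y Gy <-]; exists (x - y); first exact: GB.
      exact: rmorphB.
    by move=> a _ [x Gx <-]; exists (base_act a (x : B^o)); [exact: Ga|exact: phi_act].
  - by move=> _ ->; exists 0 => //; exact: rmorph0.
  - by move=> x Gx; exists x.
  - by move=> _ [x Gx <-]; exists x => //; exact: subrr.
apply/iso; have -> : G mu `&` phi @^-1` [set 0] = [set b | q b] `&` G mu; last first.
  exact: prime_hilb_length.
by apply/seteqP; split=> b [h1 h2]; split=> //; apply/quot_pi_eq0.
Qed.

Lemma filtered_quot (q : spectrum B) : hom_set hG [set b | q b] ->
  filtered (quot_grading q G) [:: (q, 0)].
Proof.
move=> hq; split=> [t|nu]; last by rewrite big_seq1 subr0 hilb_quot.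
rewrite inE => /eqP ->; split=> // b /(_ 1) b1; apply/quot_pi_eq0; rewrite -b1.
by rewrite /GRing.scale /= /quot_scale mulr1.
Qed.

Section Module.
Variables (M : lmodType B) (H : 'rV[int]_r -> set M).
Hypothesis hM : graded_module G H.
Hypothesis fgM : fin_gen M.

Let submod0 : is_submod (fun (b : B) (x : M) => b *: x) [set 0].
Proof. by split=> // [_ _ -> ->|a _ ->]; [exact: subr0|exact: scaler0]. Qed.

Lemma module_filtration : exists l : seq (spectrum B * 'rV[int]_r),
  [/\ filtered H l, forall nu, exists k, rel_length (@base_act A B M) [set 0] (H nu) k &
  forall p : spectrum B, (forall t, t \in l -> (forall b, t.1 b -> p b) -> t.1 = p) ->
    rel_length (fun (a : loc_ring p) (x : loc_mod p M) => a *: x)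
      [set 0] setT (count (fun t => t.1 == p) l)].
Proof.
have [hH HM] := hM.
have h0 : hom_set hH [set 0] by move=> _ nu ->; exact: gcomp0.
have [l [lann lH lloc]] := prime_filtration hG GM (standard_in_alg hB) nB HM
  (noeth_fin_gen nB fgM) submod0 h0.
have H0 nu : [set 0] `&` H nu = [set 0].
  by apply/seteqP; split=> [x []//|_ ->]; split=> //; exact: grading0.
have lH' nu : rel_length (@base_act A B M) [set 0] (H nu)
    (\sum_(t <- l) prime_hilb G t.1 (nu - t.2)%R)%N.
  rewrite -[X in rel_length _ X _ _](H0 nu); apply: lH => t tl mu.
  by apply: prime_hilb_length; case: (lann t tl).
exists l; split.
- split=> [t /lann[hq ann]|nu]; first by split=> // b b0; exact: ann.
  rewrite (hilbE (lH' nu)).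
  by elim/big_rec2: _ => // t y1 y2 _; rewrite PoszD => ->.
- by move=> nu; exists (\sum_(t <- l) prime_hilb G t.1 (nu - t.2)%R)%N.
- by move=> p /lloc; rewrite loc_set0.
Qed.

Lemma mixed_mult_eq n (d : nat) e : ndeg d (n + const_mx 1) ->
  (krull_dim M <= (d%:Z)%:E)%E -> pole_dec d (hilb H) e ->
  mixed_mult H n = e (n + const_mx 1).
Proof.
move=> nd Md he; have [l [fl _ _]] := module_filtration.
exact: mixed_mult_pole nd Md (filtered_admissible fl Md) he.
Qed.

Lemma module_pole_dec (d : nat) : (krull_dim M <= (d%:Z)%:E)%E ->
  exists e, pole_dec d (hilb H) e.
Proof.
have [l [fl _ _]] := module_filtration.
by move=> /(filtered_dec fl)[e _ he]; exists e.
Qed.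

Lemma mixed_mult_shift n (d : nat) nu : ndeg d (n + const_mx 1) ->
  (krull_dim M <= (d%:Z)%:E)%E -> mixed_mult (shift (- nu) H) n = mixed_mult H n.
Proof.
move=> nd Md; have [l [fl _ _]] := module_filtration.
have [[e e0 he] hlt] := filtered_admissible fl Md.
have hE : hilb (shift (- nu) H) = fun mu => hilb H (mu - nu).
  by apply/funext => mu; rewrite /hilb /shift addrC.
have he' : pole_dec d (hilb (shift (- nu) H)) e.
  by rewrite hE; exact: pole_dec_shift.
rewrite (mixed_mult_eq nd Md he) (mixed_mult_pole nd Md _ he') //.
split; first by exists e.
by move=> /hlt; rewrite hE; exact: pole_dec_shift.
Qed.

Lemma loc_length_gt0 (p : spectrum B) k :
  rel_length (fun (a : loc_ring p) (x : loc_mod p M) => a *: x) [set 0] setT k ->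
  supp M p <-> (0 < k)%N.
Proof.
have s0 : is_submod (fun (a : loc_ring p) (x : loc_mod p M) => a *: x) [set 0].
  by split=> // [_ _ -> ->|a _ ->]; [exact: subr0|exact: scaler0].
move=> hk; split=> [[x x0]|k0].
  have [_ /(_ 1%N setT)] := hk; apply.
  apply: (chain_toS (X := [set 0])); first by apply: chain_to0; split.
    by split.
  by split=> // /(_ x I) xE; case/eqP: x0.
apply: contrapT => nsupp; move: k0; rewrite -(max_chain_uniq _ hk (k := 0)) //.
have -> : setT = [set 0] :> set (loc_mod p M); last exact: rel_length0.
apply/seteqP; split=> // x _; apply: contrapT => x0; apply: nsupp; exists x.
by apply/eqP.
Qed.

Theorem associativity_formula n (d : nat) : ndeg d (n + const_mx 1) ->
  (krull_dim M <= (d%:Z)%:E)%E ->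
  mixed_mult H n = \sum_(p \in [set p | supp M p /\ krull_dim (quot_mod p) = krull_dim M])
    fine (loc_length p M) * mixed_mult (quot_grading p G) n.
Proof.
move=> nd Md; have [l [fl _ lloc]] := module_filtration.
have [lann hE] := fl.
have tM t : t \in l -> (krull_dim (quot_mod t.1) <= krull_dim M)%E.
  move=> /lann[_ ann]; rewrite krull_dim_quot krull_dimE.
  by apply: chain_sup_mono; exact: spec_over_mono.
have adm t : t \in l -> hilb_admissible (quot_grading t.1 G) d.
  move=> tl; have [hq _] := lann t tl.
  exact: filtered_admissible (filtered_quot hq) (le_trans (tM t tl) Md).
have sumE : mixed_mult H n = \sum_(t <- l) mixed_mult (quot_grading t.1 G) n.
  have ed t : exists e, t \in l -> pole_dec d (hilb (quot_grading t.1 G)) e.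
    have [tl|] := boolP (t \in l); last by exists (fun=> 0).
    by have [[e _ he] _] := adm t tl; exists e.
  have /choice[e He] := ed.
  rewrite (mixed_mult_eq nd Md (e := fun n => \sum_(t <- l) e t n)).
    apply: eq_big_seq => t tl; symmetry; apply: (mixed_mult_pole nd _ (adm t tl)) (He t tl).
    exact: le_trans (tM t tl) Md.
  have -> : hilb H = fun nu => \sum_(t <- l) (prime_hilb G t.1 (nu - t.2))%:Z.
    by apply/funext.
  apply: pole_dec_big => t tl; apply: (pole_dec_shift (h := fun nu => (prime_hilb G t.1 nu)%:Z)).
  have -> : (fun nu => (prime_hilb G t.1 nu)%:Z) = hilb (quot_grading t.1 G).
    by apply/funext => nu; rewrite hilb_quot //; case: (lann t tl).
  exact: He.
(* If |n + 1| were the dimension of this factor, it would also bound dim M, and the two dimensions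
   would agree. *)
have mm0 t : t \in l -> krull_dim (quot_mod t.1) <> krull_dim M ->
    mixed_mult (quot_grading t.1 G) n = 0.
  move=> tl ne; rewrite /mixed_mult; case: asboolP => // e; case: ne.
  apply/eqP; rewrite eq_le tM //= -e; have [_ ->] := ndegP _ _ nd; exact: Md.
(* A prime of [l] strictly inside [p] would have a quotient of dimension above dim M. The count
   takes place in the natural numbers: dim M is at least 0, as [p] alone is a chain, and at most
   [d]. *)
have lmin p : krull_dim (quot_mod p) = krull_dim M ->
    forall t, t \in l -> (forall b, t.1 b -> p b) -> t.1 = p.
  move=> pM t tl tp; apply: contrapT => ne.
  have [k kE] : exists k : nat, krull_dim M = (k%:Z)%:E.
    have := Md; rewrite -pM krull_dim_quot => pd.
    have : (0%:E <= chain_sup (spec_over [set a | p a]))%E.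
      by apply: (chain_sup_ge (k := 0) (X := [set a | p a])); apply: chain_to0; exists p.
    case: (chain_sup _) pd => [k|//|//]; rewrite !lee_fin => _ k0.
    by exists (absz k); rewrite gez0_abs.
  have td : dim_le [set b | t.1 b] k.
    by apply: dim_le_chain_sup; rewrite -krull_dim_quot -kE; exact: tM.
  have [k' kk' pk'] := dim_le_proper tp ne td.
  have : (krull_dim (quot_mod p) <= (k'%:Z)%:E)%E.
    by rewrite krull_dim_quot; apply: chain_sup_le => j X /pk'; rewrite lee_fin lez_nat.
  by rewrite pM kE kk' lee_fin lez_nat ltnn.
pose s := undup [seq t.1 | t <- l].
(* The sum over primes of the support is moved to the primes of [l]. Those outside the index set
   have smaller dimension and contribute 0; those inside occur in [l] because the length at [p] is
   their multiplicity there. *)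
rewrite (fsbig_fwiden s); last first.
- move=> p [/= ps npS]; rewrite /preimage /=.
  move: ps; rewrite mem_undup => /mapP[t tl pE].
  have [pM|pM] := pselect (krull_dim (quot_mod p) = krull_dim M).
    case: npS; split=> //; apply/(loc_length_gt0 (lloc p (lmin p pM))).
    by rewrite -has_count; apply/hasP; exists t => //; rewrite pE.
  by rewrite pE (mm0 t tl) ?mulr0 // -pE.
- exact: undup_uniq.
- move=> p [/= psupp pM]; rewrite mem_undup.
  have /loc_length_gt0[/(_ psupp) + _] := lloc p (lmin p pM).
  by rewrite -has_count => /hasP[t tl /eqP <-]; exact: map_f.
rewrite sumE; transitivity (\sum_(p <- s) \sum_(t <- l | t.1 == p) mixed_mult (quot_grading p G) n).
  rewrite (exchange_big_dep xpredT) //= big_seq [RHS]big_seq; apply: eq_bigr => t tl.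
  rewrite big_mkcond (bigD1_seq t.1) ?undup_uniq //=; last by rewrite mem_undup map_f.
  rewrite eqxx big1 ?addr0 // => p; by rewrite eq_sym => /negbTE ->.
rewrite big_seq [RHS]big_seq; apply: eq_bigr => p; rewrite mem_undup => /mapP[t tl pE].
have [pM|pM] := pselect (krull_dim (quot_mod p) = krull_dim M); last first.
  rewrite pE mm0 -?pE // mulr0 big1 //.
rewrite /loc_length (mod_lengthE (lloc p (lmin p pM))) /= big_const_seq iter_addr_0.
by rewrite -mulr_natl natz.
Qed.

End Module.

Section Additivity.
Variables (M' M M'' : lmodType B).
Variables (H' : 'rV[int]_r -> set M') (H : 'rV[int]_r -> set M) (H'' : 'rV[int]_r -> set M'').
Variables (f : {linear M' -> M}) (g : {linear M -> M''}).
Hypotheses (hM' : graded_module G H') (hM : graded_module G H) (hM'' : graded_module G H'').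
Hypotheses (fgM' : fin_gen M') (fgM : fin_gen M) (fgM'' : fin_gen M'').
Hypotheses (fH : forall nu x, H' nu x -> H nu (f x)).
Hypotheses (gH : forall nu x, H nu x -> H'' nu (g x)).
Hypotheses (f_inj : injective f) (fg : range f = [set x | g x = 0]) (g_onto : range g = setT).

Lemma gcomp_linear (N N' : lmodType B) (K : 'rV[int]_r -> set N) (K' : 'rV[int]_r -> set N')
    (hK : is_grading K) (hK' : is_grading K') (u : {linear N -> N'}) :
  (forall nu x, K nu x -> K' nu (u x)) ->
  forall x nu, gcomp hK' (u x) nu = u (gcomp hK x nu).
Proof.
move=> uK x nu; have [s [us s0 xE]] := gcomp_sum hK x.
rewrite (gcomp_eq hK' (c := fun nu => u (gcomp hK x nu)) (s := s)) //.
- by move=> mu; apply: uK; exact: gcomp_in.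
- by move=> mu /s0 ->; rewrite linear0.
- by rewrite {1}xE linear_sum.
Qed.

Lemma hilb_additive nu : hilb H nu = hilb H' nu + hilb H'' nu.
Proof.
have [_ [_ /(_ nu)[k' hk'] _]] := module_filtration hM' fgM'.
have [_ [_ /(_ nu)[k'' hk''] _]] := module_filtration hM'' fgM''.
have [hH' HM'] := hM'; have [hH HM] := hM; have [hH'' HM''] := hM''.
have piece (N : lmodType B) (K : 'rV[int]_r -> set N) : graded_module G K ->
    is_submod (@base_act A B N) (K nu).
  by move=> [hK KM]; exact: (piece_submod (standard_in_alg hB) hK KM).
have sub0 (N : lmodType B) : is_submod (@base_act A B N) [set 0].
  by split=> // [_ _ -> ->|a _ ->]; [exact: subr0|exact: scaler0].
(* The degree [nu] piece of the image splits the length: [Z] is isomorphic to the piece of [M'], and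
   [H nu] modulo [Z] to that of [M'']. *)
pose Z := range f `&` H nu.
have Zs : is_submod (@base_act A B M) Z.
  apply: is_submodI; last exact: piece.
  split; first by exists 0 => //; exact: linear0.
    by move=> _ _ [x _ <-] [y _ <-]; exists (x - y) => //; exact: linearB.
  by move=> a _ [x _ <-]; exists (in_alg B a *: x) => //; exact: linearZ.
have isoZ : rel_length (@base_act A B M') (H' nu `&` f @^-1` [set 0]) (H' nu) k' <->
    rel_length (@base_act A B M) [set 0] Z k'.
  apply: rel_length_iso => //.
  - exact: base_actD.
  - by move=> x y; exact: linearB.
  - by move=> a x; exact: linearZ.
  - exact: piece.
  - by move=> _ ->; split; [exists 0 => //; exact: linear0|exact: grading0].
  - by move=> x Hx; split; [exists x|exact: fH].
  (* A preimage need not be given as homogeneous; its component in degree [nu] is again a preimage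
     since [f] preserves degrees. *)
  - move=> _ [[x _ <-] Hfx]; exists (gcomp hH' x nu); first exact: gcomp_in.
    rewrite -(gcomp_linear hH' hH fH) (gcomp_homog hH nu Hfx) eqxx.
    exact: subrr.
have hZ : rel_length (@base_act A B M) [set 0] Z k'.
  apply/isoZ; rewrite (_ : _ `&` _ = [set 0]) //.
  apply/seteqP; split=> [x [_ /= fx]|_ ->]; first by apply: f_inj; rewrite linear0.
  by split; [exact: grading0|exact: linear0].
have hQ : rel_length (@base_act A B M) Z (H nu) k''.
  suff iso : rel_length (@base_act A B M) (H nu `&` g @^-1` [set 0]) (H nu) k'' <->
      rel_length (@base_act A B M'') [set 0] (H'' nu) k''.
    by rewrite /Z fg setIC; apply/iso.
  apply: rel_length_iso => //.
  - exact: base_actD.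
  - by move=> x y; exact: linearB.
  - by move=> a x; exact: linearZ.
  - exact: piece.
  - exact: piece.
  - by move=> _ ->; exact: grading0.
  - by move=> x; exact: gH.
  - move=> y Hy; have [x _ gx] : range g y by rewrite g_onto.
    exists (gcomp hH x nu); first exact: gcomp_in.
    rewrite -(gcomp_linear hH hH'' gH) gx (gcomp_homog hH'' nu Hy) eqxx.
    exact: subrr.
rewrite (hilbE hk') (hilbE hk'') -PoszD; apply: hilbE.
apply: (rel_lengthD (@base_actD A B M)) hZ hQ => //.
- exact: piece.
- by move=> _ ->; split; [exists 0 => //; exact: linear0|exact: grading0].
- by move=> x [].
Qed.

(** The annihilator of [M] kills [M'] and [M''], so [d] bounds all three dimensions and the
    decompositions can be added at that order. *)
Theorem mixed_mult_additive n (d : nat) : ndeg d (n + const_mx 1) ->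
  (krull_dim M <= (d%:Z)%:E)%E ->
  mixed_mult H n = mixed_mult H' n + mixed_mult H'' n.
Proof.
move=> nd Md.
have M'd : (krull_dim M' <= (d%:Z)%:E)%E.
  apply: le_trans Md; rewrite !krull_dimE; apply: chain_sup_mono; apply: spec_over_mono.
  by move=> a /= a0 x; apply: f_inj; rewrite linearZ linear0 /=.
have M''d : (krull_dim M'' <= (d%:Z)%:E)%E.
  apply: le_trans Md; rewrite !krull_dimE; apply: chain_sup_mono; apply: spec_over_mono.
  move=> a /= a0 y; have [x _ <-] : range g y by rewrite g_onto.
  by rewrite -linearZ /= a0 linear0.
have [e' he'] := module_pole_dec hM' fgM' M'd.
have [e'' he''] := module_pole_dec hM'' fgM'' M''d.
rewrite (mixed_mult_eq hM' fgM' nd M'd he') (mixed_mult_eq hM'' fgM'' nd M''d he'').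
rewrite (mixed_mult_eq hM fgM nd Md (e := fun n => e' n + e'' n)) //.
have -> : hilb H = fun nu => hilb H' nu + hilb H'' nu.
  by apply/funext => nu; exact: hilb_additive.
exact: pole_decD.
Qed.

End Additivity.
End Main.

Theorem lemma2p7 (r : nat) (hr : (0 < r)%N)
    (A : comNzRingType) (hA : artinian A) (hloc : local_ring A)
    (B : comAlgType A) (Bgr : 'rV[int]_r -> set B)
    (hB : standard_graded Bgr)
    (M : lmodType B) (Mgr : 'rV[int]_r -> set M)
    (hM : graded_module Bgr Mgr) (fgM : fin_gen M)
    (d : \bar int) (hd : krull_dim M = d)
    (n : 'rV[int]_r) (hn : forall i, -1 <= n 0 i)
    (hnd : (d <= (vsum (n + const_mx 1))%:E)%E) :
  [/\ (forall nu : 'rV[int]_r,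
         mixed_mult (shift (- nu) Mgr) n = mixed_mult Mgr n),
      (forall (M' M'' : lmodType B)
          (M'gr : 'rV[int]_r -> set M') (M''gr : 'rV[int]_r -> set M'')
          (f : {linear M' -> M}) (g : {linear M -> M''}),
         graded_module Bgr M'gr -> fin_gen M' ->
         graded_module Bgr M''gr -> fin_gen M'' ->
         (forall nu x, M'gr nu x -> Mgr nu (f x)) ->
         (forall nu x, Mgr nu x -> M''gr nu (g x)) ->
         injective f ->
         range f = [set x | g x = 0] ->
         range g = setT ->
         mixed_mult Mgr n = mixed_mult M'gr n + mixed_mult M''gr n) &
      mixed_mult Mgr n =
        \sum_(p \in [set p | supp M p /\ krull_dim (quot_mod p) = d])
           fine (loc_length p M) * mixed_mult (quot_grading p Bgr) n].
Proof.
have n0 i : 0 <= (n + const_mx 1) 0 i by rewrite !mxE -lerBlDr sub0r.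
(* The working order is |n + 1|, not dim M, so that equality and strict inequality are treated
   alike. *)
have nd : ndeg (absz (vsum (n + const_mx 1))) (n + const_mx 1).
  by apply/ndegP; split=> //; rewrite gez0_abs //; apply: sumr_ge0 => i _.
have Md : (krull_dim M <= ((absz (vsum (n + const_mx 1)))%:Z)%:E)%E.
  by have [_ <-] := ndegP _ _ nd; rewrite hd.
split.
- by move=> nu; exact: (mixed_mult_shift hr hA hB hM fgM nu nd Md).
- move=> M' M'' M'gr M''gr f g hM' fgM' hM'' fgM'' fH gH finj fg gonto.
  exact: (mixed_mult_additive hr hA hB hM' hM hM'' fgM' fgM fgM'' fH gH finj fg gonto nd Md).
- by rewrite (associativity_formula hr hA hB hM fgM nd Md) hd.
Qed.
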